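(* Let $(E,C)$ be a finite bipartite separated graph with $s(E^1)=E^{0,1}$ and $r(E^1)=E^{0,0}$, and let $\mathbb F$ be the free group on $E^1$. Then the partial action of $\mathbb F$ on $\Omega(E,C)$ is topologically free if and only if $(E,C)$ satisfies condition (L).
   Context: A separated graph is a pair $(E,C)$, where $E=(E^0,E^1,r,s)$ is a directed graph and $C=\bigsqcup_{v\in E^0}C_v$ with $C_v$ a partition of $r^{-1}(v)$ into nonempty subsets ($C_v=\emptyset$ if $r^{-1}(v)=\emptyset$). It is finite if $E^0,E^1$ are finite, and bipartite if $E^0=E^{0,0}\sqcup E^{0,1}$ with all arrows going from $E^{0,1}$ to $E^{0,0}$. For $e\in E^1$, $X_e$ is the unique element of $C$ containing $e$. An $(E,C)$-dynamical system is a compact Hausdorff space $\Omega$ with clopen subsets $\Omega_v$ ($v\in E^0$) with $\Omega=\bigsqcup_{v\in E^0}\Omega_v$, for each $v\in E^{0,0}$ clopen subsets $H_x\subseteq\Omega_v$ ($x\in r^{-1}(v)$) with $\Omega_v=\bigsqcup_{x\in X}H_x$ for all $X\in C_v$, and homeomorphisms $\theta_x\colon\Omega_{s(x)}\to H_x$ for all $x\in E^1$. A map $f$ between such systems is equivariant if $f(\Omega_w)\subseteq\Omega'_w$ ($w\in E^0$), $f(H_x)\subseteq H'_x$ and $f\circ\theta_x=\theta'_x\circ f$ on $\Omega_{s(x)}$ ($x\in E^1$). $\Omega(E,C)$ is the universal $(E,C)$-dynamical system: the one to which every $(E,C)$-dynamical system admits a unique continuous equivariant map; it exists, is unique up to isomorphism,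 and is a zero-dimensional metrizable compact space. The canonical partial action of $\mathbb F$ on it: for a reduced word $g=g_1\cdots g_k$ in letters $x^{\pm1}$, $x\in E^1$, $\theta_g=\theta_{g_1}\circ\cdots\circ\theta_{g_k}$ (composition of partial homeomorphisms on the largest possible domain, $\theta_{x^{-1}}=\theta_x^{-1}$), $\theta_g\colon U_{g^{-1}}\to U_g$ with all $U_g$ clopen. A partial action $\theta$ of $G$ on a compact Hausdorff space $X$, $\theta_t\colon U_{t^{-1}}\to U_t$, is topologically free if for every $t\in G\setminus\{1\}$ the set $\{x\in U_{t^{-1}}:\theta_t(x)=x\}$ has empty interior. Paths are taken in the double $\hat E$ of $E$, obtained by adding for each $e\in E^1$ an edge $e^*$ with $s(e^* )=r(e)$, $r(e^* )=s(e)$; paths are written right to left. A path $e_{2r}^*e_{2r-1}\cdots e_4^*e_3e_2^*e_1$ is admissible if $X_{e_{2i-1}}\ne X_{e_{2i}}$ (as elements of $C_{r(e_{2i-1})}=C_{r(e_{2i})}$) for $i=1,\dots,r$ and $e_{2i+1}\ne e_{2i}$ for $i=1,\dots,r-1$; the same definition applies to paths of the form $e_{2r-1}\cdots e_4^*e_3e_2^*e_1$ etc. A closed path in $(E,C)$ is a non-trivial admissible path $\gamma=e_{2r}^*e_{2r-1}\cdots e_2^*e_1$ with $s(e_1)=s(e_{2r})$. A cycle is a closed path $\gamma=e_{2r}^*e_{2r-1}\cdots e_2^*e_1$ such that $e_1\neq e_{2r}$ and $s(e_{2i-1})\ne s(e_{2j})$ for all $1\le i\le j<r$. An entry of a closed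 path $\gamma=e_{2r}^*\cdots e_2^*e_1$ is a non-trivial admissible path $x_{2t-1}x_{2t-2}^*\cdots x_4^*x_3x_2^*x_1$ such that $s(x_1)=s(e_1)$ and $|X|\ge2$ for some $X\in C_{r(x_{2t-1})}$ with $X\ne X_{x_{2t-1}}$. $(E,C)$ satisfies condition (L) if every cycle has an entry. *)

(* Defs.v *)
From HB Require Import structures.
From mathcomp Require Import all_boot all_order all_algebra.
From mathcomp Require Import all_classical all_reals all_analysis.

Set Implicit Arguments.
Unset Strict Implicit.
Unset Printing Implicit Defensive.

Local Open Scope classical_set_scope.

Record fin_sepgraph := FinSepGraph {
  vert : finType;
  edge : finType;
  src : edge -> vert;
  rng : edge -> vert;
  cls : vert -> {set {set edge}};
  (* [finset.partition] also asks that the blocks be nonempty; in particular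
     [cls v] is empty when no edge has range [v] *)
  cls_partition : forall v, finset.partition (cls v) [set e | rng e == v]%SET
}.

Arguments src {f}.
Arguments rng {f}.
Arguments cls {f}.

Record bipartite_sepgraph := BipSepGraph {
  bip_graph :> fin_sepgraph;
  vert0 : {set vert bip_graph};
  vert1 : {set vert bip_graph};
  vert01_cover : (vert0 :|: vert1 = [set: vert bip_graph])%SET;
  vert01_disj : (vert0 :&: vert1)%SET = finset.set0;
  src_vert1 : forall e, src e \in vert1;
  rng_vert0 : forall e, rng e \in vert0
}.

Section Paths.
Variable E : fin_sepgraph.

(* X_e *)
Definition class_of (e : edge E) : {set edge E} := finset.pblock (cls (rng e)) e.

(* Edges of the double: [(e, false)] stands for e and [(e, true)] for e^*. *)
Definition dedge : Type := (edge E * bool)%type.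

Definition dsrc (a : dedge) : vert E := if a.2 then rng a.1 else src a.1.
Definition drng (a : dedge) : vert E := if a.2 then src a.1 else rng a.1.

(* [adm_step a b]: the letter [b] may be traversed right after [a].  Paths are
   stored in order of traversal, so that e_n ... e_3 e_2^* e_1 is the sequence
   [:: e_1; e_2^*; e_3; ...].  Two successive letters of an admissible path
   are always one starred and one unstarred. *)
Definition adm_step (a b : dedge) : bool :=
  (drng a == dsrc b) &&
  match a.2, b.2 with
  | false, true => class_of a.1 != class_of b.1
  | true, false => a.1 != b.1
  | _, _ => false
  end.

(* A non-trivial path is given, as in [path.v], by its first letter [a] and
   the sequence [p] of its remaining letters. *)
Definition admissible (a : dedge) (p : seq dedge) : bool := path adm_step a p.

(* e_k in the path e_n ... e_3 e_2^* e_1, the index k starting from 1 *)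
Definition edge_at (a : dedge) (p : seq dedge) (k : nat) : edge E :=
  (nth a (a :: p) k.-1).1.

Definition closed_path (a : dedge) (p : seq dedge) : Prop :=
  [/\ admissible a p, ~~ a.2, (last a p).2 & src a.1 = src (last a p).1].

Definition graph_cycle (a : dedge) (p : seq dedge) : Prop :=
  let e := edge_at a p in
  let r := (size (a :: p))./2 in
  [/\ closed_path a p, e 1 <> e (2 * r) &
      forall i j : nat, 1 <= i -> i <= j -> j < r ->
        src (e (2 * i - 1)) <> src (e (2 * j))].

(* [x :: q] is an entry of the closed path [a :: p] *)
Definition path_entry (a : dedge) (p : seq dedge) (x : dedge) (q : seq dedge)
    : Prop :=
  let z := last x q in
  [/\ admissible x q, ~~ x.2, ~~ z.2, src x.1 = src a.1 &
      exists X : {set edge E},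
        [/\ X \in cls (rng z.1), X != class_of z.1 & 2 <= #|X|]].

Definition conditionL : Prop :=
  forall a p, graph_cycle a p -> exists x q, path_entry a p x q.

End Paths.

(* [f] restricts to a homeomorphism from [A] to [B] with inverse the
   restriction of [g]; the values of [f] outside [A] and of [g] outside [B]
   are irrelevant. *)
Record homeo_on (S T : topologicalType) (A : set S) (B : set T)
    (f : S -> T) (g : T -> S) : Prop := HomeoOn {
  homeo_fun : set_fun A B f;
  homeo_inv : set_fun B A g;
  homeoK : forall x, A x -> g (f x) = x;
  homeoVK : forall y, B y -> f (g y) = y;
  homeo_cont : {within A, continuous f};
  homeo_contV : {within B, continuous g}
}.

(* [pa_fun t] is meaningful on [pa_dom t^-1] only, which it maps
   homeomorphically onto [pa_dom t]. *)
Record partial_action (G : groupType) (X : topologicalType) := PartialAction {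
  pa_dom : G -> set X;
  pa_fun : G -> X -> X;
  pa_open : forall t, open (pa_dom t);
  pa_homeo : forall t, homeo_on (pa_dom t^-1%g) (pa_dom t)
                                (pa_fun t) (pa_fun t^-1%g);
  pa_dom1 : pa_dom 1%g = [set: X];
  pa_fun1 : forall x, pa_fun 1%g x = x;
  pa_comp : forall s t x,
    pa_dom t^-1%g x -> pa_dom s^-1%g (pa_fun t x) ->
    pa_dom (s * t)^-1%g x /\ pa_fun (s * t)%g x = pa_fun s (pa_fun t x)
}.

Definition topologically_free (G : groupType) (X : topologicalType)
    (theta : partial_action G X) : Prop :=
  forall t : G, t <> 1%g ->
    interior [set x | pa_dom theta t^-1%g x /\ pa_fun theta t x = x] = set0.

(* The free group on [A], realized by reduced words. *)
Section FreeGroup.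
Variable A : choiceType.

(* [(a, false)] stands for the generator a and [(a, true)] for its inverse. *)
Definition letter : Type := (A * bool)%type.
HB.instance Definition _ := Choice.on letter.

Definition letter_inv (l : letter) : letter := (l.1, ~~ l.2).

Definition reduced (w : seq letter) : bool :=
  sorted (fun l m => m != letter_inv l) w.

Record free_group := FreeGroup { word : seq letter; _ : reduced word }.

HB.instance Definition _ := [isSub for word].
HB.instance Definition _ := [Choice of free_group by <:].

(* the reduced form of [l :: w], for a reduced word [w] *)
Definition cons_letter (l : letter) (w : seq letter) : seq letter :=
  if w is m :: w' then if m == letter_inv l then w' else l :: w else [:: l].

(* the reduced form of [u ++ v], for a reduced word [v] *)
Definition word_mul (u v : seq letter) : seq letter := foldr cons_letter v u.

Definition word_inv (u : seq letter) : seq letter := rev (map letter_inv u).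

Lemma letter_invK : involutive letter_inv.
Proof. by case=> a b; rewrite /letter_inv /= negbK. Qed.

Lemma reduced_behead l w : reduced (l :: w) -> reduced w.
Proof. by case: w => //= m w /andP[]. Qed.

Lemma reduced_cons_letter l w : reduced w -> reduced (cons_letter l w).
Proof.
case: w => //= m w red_mw; case: eqVneq => [_|ne_ml] /=; last by rewrite ne_ml.
exact: reduced_behead red_mw.
Qed.

Lemma reduced_word_mul u v : reduced v -> reduced (word_mul u v).
Proof. by move=> rv; elim: u => //= l u; apply: reduced_cons_letter. Qed.

Lemma reduced_word_inv u : reduced u -> reduced (word_inv u).
Proof.
rewrite /reduced /word_inv rev_sorted sorted_map; apply: sub_sorted => l m /=.
by rewrite letter_invK eq_sym.
Qed.

Lemma cons_letterK l w :
  reduced w -> cons_letter (letter_inv l) (cons_letter l w) = w.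
Proof.
case: w => [|m w] /=; first by rewrite letter_invK eqxx.
case: eqVneq => [->|ne_ml] /=; last by rewrite letter_invK eqxx.
by case: w => //= k w /andP[/negPf-> _].
Qed.

Lemma cons_letterVK l w :
  reduced w -> cons_letter l (cons_letter (letter_inv l) w) = w.
Proof. by move=> rw; rewrite -{1}[l]letter_invK cons_letterK. Qed.

Lemma word_mul_cons_letter l u v : reduced v ->
  word_mul (cons_letter l u) v = cons_letter l (word_mul u v).
Proof.
move=> rv; case: u => //= m u; case: eqP => //= ->.
by rewrite cons_letterVK // reduced_word_mul.
Qed.

Lemma word_mulA u v w : reduced w ->
  word_mul u (word_mul v w) = word_mul (word_mul u v) w.
Proof.
by move=> rw; elim: u => //= l u ->; rewrite word_mul_cons_letter.
Qed.

Lemma word_mulw1 u : reduced u -> word_mul u [::] = u.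
Proof.
elim: u => //= l u IHu rlu; rewrite IHu ?(reduced_behead rlu)//.
by case: u rlu {IHu} => //= m u /andP[/negPf->].
Qed.

Lemma word_mulKV u v : reduced v -> word_mul (word_inv u) (word_mul u v) = v.
Proof.
move=> rv; elim: u => //= l u IHu; rewrite /word_inv/= rev_cons /word_mul.
by rewrite foldr_rcons cons_letterK ?IHu// reduced_word_mul.
Qed.

Lemma word_invK : involutive word_inv.
Proof.
by move=> u; rewrite /word_inv map_rev revK mapK//; apply: letter_invK.
Qed.

Definition fg_one : free_group := @FreeGroup [::] isT.
Definition fg_mul (g h : free_group) : free_group :=
  FreeGroup (reduced_word_mul (word g) (valP h)).
Definition fg_inv (g : free_group) : free_group :=
  FreeGroup (reduced_word_inv (valP g)).

Fact fg_mulA : associative fg_mul.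
Proof. by move=> u v w; apply/val_inj/word_mulA/valP. Qed.

Fact fg_mul1g : left_id fg_one fg_mul.
Proof. by move=> u; apply/val_inj. Qed.

Fact fg_mulg1 : right_id fg_one fg_mul.
Proof. by move=> u; apply/val_inj/word_mulw1/valP. Qed.

Fact fg_mulVg : left_inverse fg_one fg_inv fg_mul.
Proof.
move=> u; apply/val_inj; rewrite /= -{2}[word u]word_mulw1 ?word_mulKV//.
exact: valP.
Qed.

Fact fg_mulgV : right_inverse fg_one fg_inv fg_mul.
Proof.
move=> u; have <- := fg_mulVg (fg_inv u); congr fg_mul.
by apply/val_inj; rewrite /= word_invK.
Qed.

HB.instance Definition _ :=
  isGroup.Build free_group fg_mulA fg_mul1g fg_mulg1 fg_mulVg fg_mulgV.

End FreeGroup.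

Record dyn_system (E : bipartite_sepgraph) := DynSystem {
  ds_space :> topologicalType;
  ds_compact : compact [set: ds_space];
  ds_hausdorff : hausdorff_space ds_space;
  (* Omega_v *)
  ds_part : vert E -> set ds_space;
  ds_part_clopen : forall v, clopen (ds_part v);
  ds_part_cover : \bigcup_(v in [set: vert E]) ds_part v = [set: ds_space];
  ds_part_triv : trivIset [set: vert E] ds_part;
  (* H_x *)
  ds_image : edge E -> set ds_space;
  ds_image_clopen : forall x, clopen (ds_image x);
  ds_image_sub : forall x, ds_image x `<=` ds_part (rng x);
  ds_image_cover : forall v X, v \in vert0 E -> X \in cls v ->
    \bigcup_(x in [set` X]) ds_image x = ds_part v;
  ds_image_triv : forall v X, v \in vert0 E -> X \in cls v ->
    trivIset [set` X] ds_image;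
  (* theta_x and its inverse *)
  ds_map : edge E -> ds_space -> ds_space;
  ds_mapV : edge E -> ds_space -> ds_space;
  ds_map_homeo : forall x,
    homeo_on (ds_part (src x)) (ds_image x) (ds_map x) (ds_mapV x)
}.

Arguments ds_part {E} d v.
Arguments ds_image {E} d x.
Arguments ds_map {E} d x y.
Arguments ds_mapV {E} d x y.

Section DynSystem.
Variable E : bipartite_sepgraph.

Record equivariant (S T : dyn_system E) (f : S -> T) : Prop := Equivariant {
  equiv_part : forall w, f @` ds_part S w `<=` ds_part T w;
  equiv_image : forall x, f @` ds_image S x `<=` ds_image T x;
  equiv_map : forall x y, ds_part S (src x) y ->
    f (ds_map S x y) = ds_map T x (f y)
}.

Definition universal_system (T : dyn_system E) : Prop :=
  forall S : dyn_system E, exists! f : S -> T, continuous f /\ equivariant f.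

Variable T : dyn_system E.

Local Notation letterE := (letter (edge E)).

(* the domain and the values of theta_x and theta_{x^-1} *)
Definition letter_dom (l : letterE) : set T :=
  if l.2 then ds_image T l.1 else ds_part T (src l.1).
Definition letter_fun (l : letterE) : T -> T :=
  if l.2 then ds_mapV T l.1 else ds_map T l.1.

(* theta_{g_1} \o ... \o theta_{g_k} and its largest possible domain, for the
   word [:: g_1; ...; g_k] *)
Fixpoint word_fun (w : seq letterE) : T -> T :=
  if w is l :: w' then letter_fun l \o word_fun w' else id.
Fixpoint word_dom (w : seq letterE) : set T :=
  if w is l :: w' then word_dom w' `&` (word_fun w' @^-1` letter_dom l)
  else setT.

Lemma letter_homeo l : homeo_on (letter_dom l) (letter_dom (letter_inv l))
  (letter_fun l) (letter_fun (letter_inv l)).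
Proof.
have [] := ds_map_homeo T l.1.
by case: l => x [] /= *; split.
Qed.

Lemma letter_dom_open l : open (letter_dom l).
Proof.
by rewrite /letter_dom; case: ifP => _;
  [have [] := ds_image_clopen T l.1 | have [] := ds_part_clopen T (src l.1)].
Qed.

Lemma letter_fun_cont l x : letter_dom l x -> {for x, continuous (letter_fun l)}.
Proof.
move=> lx; have := homeo_cont (letter_homeo l).
rewrite continuous_open_subspace; last exact: letter_dom_open.
by apply; rewrite inE.
Qed.

Lemma word_fun_cont w x : word_dom w x -> {for x, continuous (word_fun w)}.
Proof.
elim: w x => [|l w IHw] x /=; first by move=> _; apply: cvg_id.
move=> [wx lx]; apply: continuous_comp; first exact: IHw.
exact: letter_fun_cont.
Qed.

Lemma word_dom_open w : open (word_dom w).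
Proof.
elim: w => [|l w IHw] /=; first exact: openT.
rewrite openE => x [wx lx]; apply: filterI; first exact: open_nbhs_nbhs.
by apply: (word_fun_cont wx); apply: open_nbhs_nbhs; split=> //;
   apply: letter_dom_open.
Qed.

Lemma word_fun_within w : {within word_dom w, continuous (word_fun w)}.
Proof.
rewrite continuous_open_subspace; last exact: word_dom_open.
by move=> x; rewrite inE; apply: word_fun_cont.
Qed.

Lemma word_cat u v x :
  (word_dom (u ++ v) x <-> word_dom v x /\ word_dom u (word_fun v x)) /\
  word_fun (u ++ v) x = word_fun u (word_fun v x).
Proof.
elim: u => [|l u [IHd IHf]] /=; first by split=> //; split=> // -[].
split; last by rewrite IHf.
rewrite /preimage /= IHf; split; first by move=> [/IHd[? ?] ?].
by move=> [? [? ?]]; split=> //; apply/IHd.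
Qed.

Lemma word_inv_act w x : word_dom w x ->
  word_dom (word_inv w) (word_fun w x) /\
  word_fun (word_inv w) (word_fun w x) = x.
Proof.
elim: w x => [|l w IHw] x //= [wx lx].
have [h1 _ h2 _ _ _] := letter_homeo l.
rewrite /word_inv/= rev_cons -cats1 -/(word_inv w).
have [[_ Hd] ->] := word_cat (word_inv w) [:: letter_inv l]
                            (letter_fun l (word_fun w x)).
rewrite /= h2//; have [? ?] := IHw _ wx; split=> //; apply: Hd => /=.
by rewrite h2//; split=> //; split=> //; apply: h1.
Qed.

Lemma cons_letter_act l w x : word_dom (l :: w) x ->
  word_dom (cons_letter l w) x /\
  word_fun (cons_letter l w) x = word_fun (l :: w) x.
Proof.
case: w => [//|m w] /=; case: eqP => [->|_ [H1 H2]]; last by split.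
move=> [[wx mx] _]; split=> //.
by have /= := homeoK (letter_homeo (letter_inv l)) mx; rewrite letter_invK => ->.
Qed.

Lemma word_mul_act u v x : word_dom v x -> word_dom u (word_fun v x) ->
  word_dom (word_mul u v) x /\
  word_fun (word_mul u v) x = word_fun u (word_fun v x).
Proof.
move=> vx; elim: u => [|l u IHu] //= [ux lx]; have [h1 h2] := IHu ux.
have [|d e] := @cons_letter_act l (word_mul u v) x.
  by split=> //=; rewrite /preimage/= h2.
by split=> //; rewrite e /= h2.
Qed.

Local Notation FE := (free_group (edge E)).

(* U_g is the domain of theta_{g^-1} *)
Definition canonical_dom (g : FE) : set T := word_dom (word g^-1%g).
Definition canonical_fun (g : FE) : T -> T := word_fun (word g).

Lemma canonical_homeo g : homeo_on (canonical_dom g^-1%g) (canonical_dom g)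
  (canonical_fun g) (canonical_fun g^-1%g).
Proof.
rewrite /canonical_dom /canonical_fun invgK; split.
- by move=> x /word_inv_act[].
- by move=> x /word_inv_act[/= + _]; rewrite word_invK.
- by move=> x /word_inv_act[].
- by move=> x /word_inv_act[/= _]; rewrite word_invK.
- exact: word_fun_within.
- exact: word_fun_within.
Qed.

Lemma canonical_comp s t x :
  canonical_dom t^-1%g x -> canonical_dom s^-1%g (canonical_fun t x) ->
  canonical_dom (s * t)^-1%g x /\
  canonical_fun (s * t)%g x = canonical_fun s (canonical_fun t x).
Proof.
rewrite /canonical_dom /canonical_fun !invgK; exact: word_mul_act.
Qed.

Definition canonical_action : partial_action FE T :=
  @PartialAction FE T canonical_dom canonical_fun
    (fun g => @word_dom_open _) canonical_homeo erefl (fun=> erefl)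
    canonical_comp.

End DynSystem.

(* Main.v *)
Require Import Defs.
From mathcomp Require Import all_boot all_order all_algebra.
From mathcomp Require Import all_classical all_reals all_analysis.
From mathcomp Require Import zify.

(** Reading a point of a dynamical system through the words that can be applied
to it yields its configuration: a subtree of the Cayley graph of the free group
through 1, whose nodes carry vertices of the graph.  A node carrying v in
E^{0,1} has a neighbour along every edge of source v, and a node carrying v in
E^{0,0} has, for each X in C_v, a neighbour along x^-1 for exactly one x in X.
Configurations form a compact Hausdorff space, which becomes a dynamical system
when the root is moved ([tree_system]).  Applying the universal property of
Omega to this system and to Omega itself shows that points of Omega are
determined by their configurations, and that every configuration comes from a
point that depends continuously on it ([universal_retract]).  Both implications
are then statements on configurations.

Topological freeness implies (L).  If a cycle based at v has no entry, then no
block with several elements is met along admissible paths from v, so that there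
is only one configuration rooted at v.  Hence Omega_v is a single point, which
is open and is fixed by the group element of the cycle ([forced_path],
[part_singleton]).

(L) implies topological freeness.  Let t <> 1 fix every point of a nonempty open
set.  When t has minimal length it is cyclically reduced, its word is a closed
path, and conjugation moves the base point to any vertex of this path
([min_fixes_conj]).  This closed path need not be a cycle, but it always passes
through a vertex with an entry ([closed_path_entry]).  The configuration of a
point of the open set has period t, so it contains the translates of the entry
by all powers of t, and at the end of each of them an edge is chosen in a block
with several elements.  An open set only controls finitely many coordinates:
changing the choice at a sufficiently far translate gives a point that is still
in the open set, but whose configuration no longer has period t
([fixes_far_entry]). *)

Set Implicit Arguments.
Unset Strict Implicit.
Unset Printing Implicit Defensive.

(** * Reduced words *)

Section FreeGroupWords.
Variable A : choiceType.
Local Notation FA := (free_group A).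

Definition gen (l : letter A) : FA := @FreeGroup A [:: l] isT.

Lemma word_gen l (g : FA) : word (gen l * g)%g = cons_letter l (word g).
Proof. by []. Qed.

Lemma word_inj : injective (@word A).
Proof. exact: val_inj. Qed.

Lemma genV l : ((gen l)^-1 = gen (letter_inv l))%g.
Proof. exact: word_inj. Qed.

Lemma genVK l (g : FA) : (gen l * (gen (letter_inv l) * g) = g)%g.
Proof. by rewrite -genV mulVKg. Qed.

Lemma letter_inv_neq (l : letter A) : l != letter_inv l.
Proof. by case: l => x b; rewrite /letter_inv xpair_eqE eqxx /=; case: b. Qed.

Lemma word_cons_gen (g : FA) l w : word g = l :: w ->
  exists h : FA, g = (gen l * h)%g /\ word h = w.
Proof.
move=> eg; have rg := valP g; rewrite /= eg in rg.
exists (FreeGroup (reduced_behead rg)); split=> //.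
apply: word_inj; rewrite eg word_gen /=.
by case: w rg {eg} => //= m w /andP[/negPf->].
Qed.

Lemma word_gen_cons (g h : FA) l :
  word g = l :: word h -> g = (gen l * h)%g.
Proof. by move=> /word_cons_gen[h' [-> /word_inj ->]]. Qed.

Lemma word_gen_neq l (g : FA) : (forall w, word g <> letter_inv l :: w) ->
  word (gen l * g)%g = l :: word g.
Proof.
by rewrite word_gen /cons_letter; case: (word g) => // m w H;
  case: eqP => // em; case: (H w); rewrite em.
Qed.

Lemma word_mul_cat (g h : FA) : reduced (word g ++ word h) ->
  word (g * h)%g = word g ++ word h.
Proof.
change (word (g * h)%g) with (word_mul (word g) (word h)).
elim: (word g) => //= l u IHu rlu; rewrite IHu; last exact: reduced_behead rlu.
by case: (u ++ _) rlu => //= m u' /andP[/negPf->].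
Qed.

Lemma reduced_cat (u : seq (letter A)) m l v :
  reduced (rcons u m) -> reduced (l :: v) -> l != letter_inv m ->
  reduced (rcons u m ++ l :: v).
Proof.
rewrite /reduced; case: u => [|a u] /=; first by move=> _ -> ->.
by rewrite cat_path last_rcons /= => -> -> ->.
Qed.

Lemma reduced_catl (u v : seq (letter A)) : reduced (u ++ v) -> reduced u.
Proof. by rewrite /reduced; case: u => //= a u; rewrite cat_path => /andP[]. Qed.

Lemma reduced_catr (u v : seq (letter A)) : reduced (u ++ v) -> reduced v.
Proof. by elim: u => //= l u IHu /reduced_behead. Qed.

End FreeGroupWords.

(** * The blocks of a separated graph *)

Section Classes.
Variable E : fin_sepgraph.
Implicit Types (x y : edge E) (X : {set edge E}).

Lemma cover_cls v : finset.cover (cls v) = [set e : edge E | rng e == v]%SET.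
Proof. exact: cover_partition (cls_partition v). Qed.

Lemma class_of_cls x : class_of x \in cls (rng x).
Proof. by apply: pblock_mem; rewrite cover_cls inE. Qed.

Lemma mem_class_of x : x \in class_of x.
Proof. by rewrite mem_pblock cover_cls inE. Qed.

Lemma cls_rng v X x : X \in cls v -> x \in X -> rng x = v.
Proof.
move=> Xv xX; have : x \in finset.cover (cls v) by apply/finset.bigcupP; exists X.
by rewrite cover_cls inE => /eqP.
Qed.

Lemma cls_class v X x : X \in cls v -> x \in X -> class_of x = X.
Proof.
move=> Xv xX; rewrite /class_of (cls_rng Xv xX); apply: def_pblock => //.
by case/and3P: (cls_partition v).
Qed.

Lemma cls_neq0 v X : X \in cls v -> exists x, x \in X.
Proof.
move=> Xv; case/and3P: (cls_partition v) => _ _ n0; apply/finset.set0Pn.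
by apply: contraNneq n0 => <-.
Qed.

End Classes.

(** * Configurations *)

Section Configurations.
Variable E : bipartite_sepgraph.
Local Notation FE := (free_group (edge E)).
Implicit Types (g h : FE) (x y : edge E) (u v : vert E).

Lemma vert01 v : v \in vert1 E -> v \in vert0 E -> False.
Proof.
by move=> v1 v0; have := finset.in_set0 v; rewrite -(vert01_disj E) inE v0 v1.
Qed.

(** Here [xi (g, v)] stands for: theta_g is defined at the point and sends it to
Omega_v.  Since a reduced word can be applied only if its right parts can,
[cfg_tree] asks the support to be connected to 1; all other conditions are local
and invariant under right translations. *)
Record is_config (xi : FE * vert E -> bool) : Prop := IsConfig {
  cfg_root : exists v, xi (1%g, v);
  cfg_fun : forall g u v, xi (g, u) -> xi (g, v) -> u = v;
  cfg_edge : forall g x, xi (g, src x) -> xi (gen (x, false) * g, rng x)%g;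
  cfg_choice : forall g v X, X \in cls v -> xi (g, v) ->
    exists2 x, x \in X & xi (gen (x, true) * g, src x)%g;
  cfg_choice_uniq : forall g x y, class_of x = class_of y ->
    xi (gen (x, true) * g, src x)%g -> xi (gen (y, true) * g, src y)%g -> x = y;
  cfg_tree : forall g l h u, word g = l :: word h -> xi (g, u) ->
    xi (h, dsrc l) /\ u = drng l
}.

(** The configuration of theta_m p, when xi is that of p. *)
Definition reroot (m : FE) (xi : FE * vert E -> bool) : FE * vert E -> bool :=
  fun p => xi (p.1 * m, p.2)%g.

Lemma drng_inv (l : dedge E) : drng (letter_inv l) = dsrc l.
Proof. by case: l => x []. Qed.

Lemma dsrc_inv (l : dedge E) : dsrc (letter_inv l) = drng l.
Proof. by case: l => x []. Qed.

(** Only the connectedness of the support is at stake.  Right multiplication by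
[m] changes reduced words at their right end, so the word of [l * h * m] still
starts with [l], except when [h = 1] and [m = l^-1]; then [g * m = 1] and
[h * m = m], which belong to the support by hypothesis. *)
Lemma reroot_config xi (m : dedge E) : is_config xi -> xi (gen m, drng m) ->
  is_config (reroot (gen m) xi).
Proof.
move=> cxi xim; rewrite /reroot; split => /=.
- by exists (drng m); rewrite mul1g.
- by move=> g u v; apply: cfg_fun.
- by move=> g x xg; rewrite -mulgA; apply: cfg_edge.
- move=> g v X Xv xg; have [x xX xx] := cfg_choice cxi Xv xg.
  by exists x; rewrite -?mulgA.
- by move=> g x y exy; rewrite -!mulgA; apply: cfg_choice_uniq.
move=> g l h u wg xg.
have eg : g = (gen l * h)%g by apply: word_gen_cons.
have eglm : (g * gen m)%g = (gen l * (h * gen m))%g by rewrite eg mulgA.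
have : word (gen l * (h * gen m))%g = cons_letter l (word (h * gen m)%g) by [].
rewrite /cons_letter -eglm; case ehm: (word (h * gen m)%g) => [|k w].
  by move=> egm; apply: (cfg_tree cxi) xg; rewrite egm ehm.
case: eqP => [ek|_] egm; last by apply: (cfg_tree cxi) xg; rewrite egm ehm.
have h1 : h = 1%g /\ m = letter_inv l.
  have rg := valP g; rewrite /= wg in rg.
  have rh := valP h; rewrite /= in rh.
  have := ehm; change (word (h * gen m)%g) with (word_mul (word h) [:: m]).
  have [w' eh] : exists w', word h = w' by exists (word h).
  rewrite eh in rg rh *; case/lastP: w' eh rg rh => [|s k'] eh rg rs.
    rewrite /= => -[em _]; split; last by rewrite em ek.
    by apply: word_inj; rewrite eh.
  move=> rh; have [ek'|nk'] := eqVneq m (letter_inv k').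
    exfalso; move: rh; rewrite /word_mul foldr_rcons /= ek' eqxx.
    have {}rs : reduced s by rewrite -cats1 in rs; exact: reduced_catl rs.
    rewrite -/(word_mul s [::]) word_mulw1// => es.
    by move: rg; rewrite es ek /= eqxx.
  have rm : reduced (rcons s k' ++ [:: m]) by apply: reduced_cat.
  have := @word_mul_cat _ (FreeGroup rs) (gen m) rm.
  change (word (FreeGroup rs * gen m)%g) with (word_mul (rcons s k') [:: m]).
  rewrite rh /= => es; exfalso; move: es rg.
  by case: s {eh rs nk' rm rh} => [|a s] /= [<- _]; rewrite ek eqxx.
have [{}h1 em] := h1.
have gm1 : (g * gen m = 1)%g by rewrite eg h1 mulg1 em -genV mulgV.
rewrite gm1 in xg; rewrite h1 mul1g; rewrite em drng_inv in xim *; split=> //.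
have [] := @cfg_tree _ cxi (gen (letter_inv l)) (letter_inv l) 1%g _ erefl xim.
by rewrite dsrc_inv => x1 _; apply: cfg_fun cxi _ _ _ xg x1.
Qed.

End Configurations.

(** * Trees grown by a choice of edges *)

Section PolicyTrees.
Local Open Scope classical_set_scope.
Variable E : bipartite_sepgraph.
Local Notation FE := (free_group (edge E)).
Local Notation word_t := (seq (letter (edge E))).
Implicit Types (g h : FE) (x y : edge E) (u v : vert E) (w : word_t).

(** A policy selects an edge in each block at each node of the tree.
[policy_back] makes it select, in the block of the edge just traversed, this
very edge: the tree is then closed under going back. *)
Record is_policy (pi : word_t -> {set edge E} -> option (edge E)) : Prop :=
  IsPolicy {
    policy_mem : forall w v X, X \in cls v ->
      exists2 x, pi w X = Some x & x \in X;
    policy_back : forall w x, pi ((x, false) :: w) (class_of x) = Some x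
  }.

Variable pi : word_t -> {set edge E} -> option (edge E).

(** The vertex reached by the word [w], read from right to left, from the
vertex [v], when every inverse letter is the one selected by [pi]. *)
Fixpoint tree_label v w : option (vert E) :=
  if w is l :: w' then
    if (tree_label v w' == Some (dsrc l)) &&
       (l.2 ==> (pi w' (class_of l.1) == Some l.1))
    then Some (drng l) else None
  else Some v.

Definition tree_config v : FE * vert E -> bool :=
  fun p => tree_label v (word p.1) == Some p.2.

Hypothesis pol : is_policy pi.
Variable v : vert E.

Lemma tree_config_cons g l h u : word g = l :: word h ->
  tree_config v (g, u) = [&& tree_config v (h, dsrc l),
    l.2 ==> (pi (word h) (class_of l.1) == Some l.1) & u == drng l].
Proof.
rewrite /tree_config /= => -> /=.
case: (tree_label v (word h) == _) => //=; case: (_ ==> _) => //=.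
by rewrite eq_sym.
Qed.

Lemma tree_config_edge g x :
  tree_config v (g, src x) -> tree_config v (gen (x, false) * g, rng x)%g.
Proof.
move=> xg; have [[w wg]|nwg] := pselect (exists w, word g = (x, true) :: w).
  have [h [eg wh]] := word_cons_gen wg.
  have {}wg : word g = (x, true) :: word h by rewrite wh.
  move: xg; rewrite (tree_config_cons _ wg) => /and3P[+ _ _].
  by rewrite eg genVK.
have -> := tree_config_cons (rng x) (@word_gen_neq _ (x, false) g _).
  by rewrite /= xg eqxx.
by move=> w wg; apply: nwg; exists w.
Qed.

Lemma tree_config_choice g x : tree_config v (g, rng x) ->
  tree_config v (gen (x, true) * g, src x)%g
  = (pi (word g) (class_of x) == Some x).
Proof.
move=> xg; have [[w wg]|nwg] := pselect (exists w, word g = (x, false) :: w).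
  have [h [eg wh]] := word_cons_gen wg.
  have wg' : word g = (x, false) :: word h by rewrite wh.
  move: xg; rewrite (tree_config_cons _ wg') => /and3P[/= xh _ _].
  rewrite wg (policy_back pol) eqxx eg.
  by rewrite genVK.
have -> := tree_config_cons (src x) (@word_gen_neq _ (x, true) g _).
  by rewrite /= xg eqxx andbT.
by move=> w wg; apply: nwg; exists w.
Qed.

Lemma tree_config_rng g x :
  tree_config v (gen (x, true) * g, src x)%g -> tree_config v (g, rng x).
Proof. by move=> /tree_config_edge; rewrite genVK. Qed.

Lemma tree_config_is_config : is_config (tree_config v).
Proof.
split.
- by exists v; rewrite /tree_config /= eqxx.
- by move=> g u u' /eqP /= e1 /eqP /=; rewrite e1 => -[].
- exact: tree_config_edge.
- move=> g u X Xu ug; have [x px xX] := policy_mem pol (word g) Xu.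
  exists x => //; rewrite tree_config_choice ?(cls_class Xu)// ?px//.
  by rewrite (cls_rng Xu).
- move=> g x y exy xg yg; move: (xg) (yg).
  rewrite !tree_config_choice ?tree_config_rng// exy => /eqP -> /eqP[].
  by [].
- by move=> g l h u wg; rewrite (tree_config_cons _ wg) => /and3P[? _ /eqP].
Qed.

End PolicyTrees.

(** * Configurations as grown trees *)

Section PolicyOfConfig.
Local Open Scope classical_set_scope.
Variable E : bipartite_sepgraph.
Local Notation FE := (free_group (edge E)).
Local Notation word_t := (seq (letter (edge E))).
Implicit Types (g h : FE) (x y : edge E) (u v : vert E) (w : word_t).

(** The selection at a node only affects strictly longer words: this is what
allows changing a choice without changing the tree nearby. *)
Lemma eq_tree_config pi pi' v N :
  (forall w, size w < N -> pi w = pi' w)%N ->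
  forall g u, (size (word g) <= N)%N ->
    tree_config pi v (g, u) = tree_config pi' v (g, u).
Proof.
move=> epi g u; rewrite /tree_config /=.
suff H w : (size w <= N)%N -> tree_label pi v w = tree_label pi' v w.
  by move=> /H ->.
by elim: w => //= l w IHw wN; rewrite IHw ?epi// ltnW.
Qed.

(** Any function becomes a policy once the values that violate the two
constraints are replaced. *)
Definition policy_of (f : word_t -> {set edge E} -> option (edge E)) w X :=
  let dflt := if f w X is Some y then
                if y \in X then Some y else [pick z in X]
              else [pick z in X] in
  if w is (x, false) :: _ then if x \in X then Some x else dflt else dflt.

Lemma policy_of_policy f : is_policy (policy_of f).
Proof.
split=> [w v X Xv|w x]; last by rewrite /= mem_class_of.
have {Xv}[z zX] := cls_neq0 Xv.
have pickX : exists2 x, [pick z in X] = Some x & x \in X.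
  by case: pickP => [y yX|/(_ z)]; [exists y | rewrite zX].
have dfltX : exists2 x, (if f w X is Some y then
                if y \in X then Some y else [pick z in X]
              else [pick z in X]) = Some x & x \in X.
  by case: (f w X) => // y; case: ifP => // yX; exists y.
by case: w dfltX => //= -[x []] w // dfltX; case: ifP => // xX; exists x.
Qed.

(** The value at words that are not reduced is irrelevant. *)
Definition word_elt w : FE :=
  if pselect (reduced w) is left r then FreeGroup r else 1%g.

Lemma word_eltK g : word_elt (word g) = g.
Proof.
rewrite /word_elt; case: pselect => [r|]; first exact: word_inj.
by case; exact: (valP g).
Qed.

Variables (xi : FE * vert E -> bool) (cxi : is_config xi) (v : vert E).
Hypothesis xi1 : xi (1%g, v).

Definition config_choice w (X : {set edge E}) :=
  [pick y in X | xi (gen (y, true) * word_elt w, src y)%g].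

Lemma config_rng g x : xi (gen (x, true) * g, src x)%g -> xi (g, rng x).
Proof. by move=> /(cfg_edge cxi); rewrite genVK. Qed.

Lemma config_choiceP g x : xi (gen (x, true) * g, src x)%g ->
  policy_of config_choice (word g) (class_of x) = Some x.
Proof.
move=> xg; have cx : config_choice (word g) (class_of x) = Some x.
  rewrite /config_choice word_eltK; case: pickP => [y /andP[yX yg]|/(_ x)].
    by congr Some; apply: (cfg_choice_uniq cxi) yg xg;
       apply: cls_class (class_of_cls x) yX.
  by rewrite mem_class_of xg.
rewrite /policy_of cx mem_class_of; case wg: (word g) => [|[y []] w]//.
case: ifP => // yX; congr Some.
have [h [eg _]] := word_cons_gen wg.
apply: (cfg_choice_uniq cxi (cls_class (class_of_cls x) yX) _ xg).
rewrite eg genVK.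
have := config_rng xg; have [] := @cfg_tree _ _ cxi g (y, false) h (rng x).
- rewrite wg; congr (_ :: _).
  have [h' [eg' <-]] := word_cons_gen wg.
  by rewrite eg in eg'; have /mulgI -> := eg'.
- exact: config_rng xg.
by move=> + _ _.
Qed.

(** Every configuration is grown by the policy of its own choices, so new ones
can be obtained by altering this policy. *)
Lemma config_tree p : xi p = tree_config (policy_of config_choice) v p.
Proof.
case: p => g u; move: {2}(word g) (erefl (word g)) => w; elim: w g u.
  move=> g u wg; have -> : g = 1%g by apply: word_inj; rewrite wg.
  rewrite /tree_config /=; apply/idP/eqP => [xu|[<-//]].
  by rewrite (cfg_fun cxi xi1 xu).
move=> l w IHw g u wg; have [h [eg wh]] := word_cons_gen wg.
have {}wg : word g = l :: word h by rewrite wh.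
rewrite (tree_config_cons _ _ _ wg) -IHw//.
apply/idP/and3P => [xg|[xh]].
  have [xh eu] := cfg_tree cxi wg xg; rewrite eu eqxx; split=> //.
  case: l wg eg eu xh => x [] //= wg eg eu xh.
  by apply/eqP/config_choiceP; rewrite -eg; move: xg; rewrite eu.
rewrite eg; case: l {wg eg} xh => x [] /= xh; last first.
  by move=> _ /eqP ->; apply: cfg_edge.
move=> /eqP px /eqP ->; have [y yX yh] := cfg_choice cxi (class_of_cls x) xh.
have := config_choiceP yh; rewrite (cls_class (class_of_cls x) yX) px.
by move=> [->].
Qed.

End PolicyOfConfig.

(** * Admissible paths in a configuration *)

Section Paths.
Variable E : bipartite_sepgraph.
Local Notation FE := (free_group (edge E)).
Implicit Types (g h : FE) (x y z : edge E) (u v : vert E).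

(** Words act from right to left, so their letters are in the order opposite to
that of traversal. *)
Definition adm_word (w : seq (dedge E)) := sorted (fun b a => adm_step a b) w.

Lemma adm_word_rev w : adm_word (rev w) = sorted (@adm_step E) w.
Proof. by rewrite /adm_word rev_sorted. Qed.

Lemma adm_step_neq (a b : dedge E) : adm_step a b -> b != letter_inv a.
Proof.
case: a b => x [] [y []] /andP[_] //=; rewrite /letter_inv /= xpair_eqE ?andbT.
  by rewrite eq_sym.
by apply: contraNneq => ->.
Qed.

Lemma adm_word_reduced w : adm_word w -> @reduced (edge E) w.
Proof.
apply: sub_sorted => b a /adm_step_neq; apply: contraNneq => ->.
by rewrite letter_invK.
Qed.

(** An entry only depends on the base point of the closed path, which is the only
datum kept here. *)
Definition has_entry v := exists (x : dedge E) q, let z := last x q in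
  [/\ admissible x q, ~~ x.2, ~~ z.2, src x.1 = v &
      exists X : {set edge E},
        [/\ X \in cls (rng z.1), X != class_of z.1 & 2 <= #|X|]].

(** An entry that lies in the configuration: by [cfg_tree], it suffices to ask
this of its last node. *)
Definition entry_in (xi : FE * vert E -> bool) x := exists h z w X,
  [/\ word h = (z, false) :: w, last (z, false) w = (x, false),
      xi (h, rng z), X \in cls (rng z) & X != class_of z /\ 2 <= #|X|].

Variables (xi : FE * vert E -> bool) (cxi : is_config xi) (v : vert E).
Hypotheses (xi1 : xi (1%g, v)).

Lemma config_drng g l w u : word g = l :: w -> xi (g, u) -> u = drng l.
Proof.
move=> /[dup] wg /word_cons_gen[h [_ wh]] /(@cfg_tree _ _ cxi g l h)[]//.
by rewrite wg wh.
Qed.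

(** Bipartiteness makes unstarred and starred letters alternate.  Two edges of
the same block around a node of type E^{0,0} would both be the choice in this
block, hence equal, which a reduced word excludes. *)
Lemma config_path g u l w : v \in vert1 E -> word g = l :: w -> xi (g, u) ->
  [/\ adm_word (word g), ~~ (last l w).2 & dsrc (last l w) = v].
Proof.
move=> v1; elim: w g u l => [|m w IHw] g u l wg xg;
  have [h [eg wh]] := word_cons_gen wg;
  have [xh _] := @cfg_tree _ _ cxi g l h u (eq_trans wg (congr1 _ (esym wh))) xg.
  have h1 : h = 1%g by apply: word_inj; rewrite wh.
  rewrite h1 in xh; have el := cfg_fun cxi xh xi1.
  split=> //=; first by rewrite wg.
  case: l el {wg eg xh} => x [] //= el; exfalso; apply: (vert01 v1).
  by rewrite -el rng_vert0.
have [aw l2 ls] := IHw _ _ _ wh xh.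
split=> //; clear l2 ls; rewrite wg -wh /adm_word /= wh /= andbC.
rewrite -[X in X && _]/(adm_word (m :: w)) -wh aw /=.
have em := config_drng wh xh.
have ml : m != letter_inv l.
  by have := valP g; rewrite /= wg /= => /andP[].
rewrite /adm_step em eqxx /=.
move: em ml wh wg eg xh; case: l => x []; case: m => z [];
  rewrite /dsrc /drng //= => em ml wh wg eg xh.
- by case: (vert01 (src_vert1 z)); rewrite -em rng_vert0.
- apply: contra_neqN ml => /eqP ezx; rewrite /letter_inv /=; congr (_, _).
  have [k [eh _]] := word_cons_gen wh.
  apply: (cfg_choice_uniq cxi (g := h) ezx).
    rewrite eh genVK.
    rewrite em in xh.
    have [] // := @cfg_tree _ _ cxi h (z, false) k _ _ xh.
    rewrite wh; congr (_ :: _); have [k' [eh' <-]] := word_cons_gen wh.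
    by rewrite eh in eh'; have /mulgI -> := eh'.
  by have eu := config_drng wg xg; rewrite -eg; move: xg; rewrite eu.
- by apply: contra_neqN ml => /eqP ->.
- by case: (vert01 (src_vert1 x)); rewrite em rng_vert0.
Qed.

Lemma entry_in_has_entry x : v \in vert1 E -> entry_in xi x -> has_entry v.
Proof.
move=> v1 [h [z [w [X [wh lw xh Xz [nX cX]]]]]].
have [aw l2 ls] := config_path v1 wh xh; rewrite lw in l2 ls.
have := adm_word_rev (rev (word h)); rewrite revK aw wh rev_cons.
case: (lastP w) lw {wh} => [|w' a] lw.
  rewrite /= => _; exists (z, false), [::]; split=> //=.
    by move: ls; rewrite -[in LHS]lw.
  by exists X; rewrite ?negbK.
rewrite last_rcons in lw; rewrite lw rev_rcons /= => /esym ad.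
exists (x, false), (rcons (rev w') (z, false)); split=> //=.
- by rewrite last_rcons.
- by rewrite last_rcons; exists X.
Qed.

(** The path is followed until it asks for an edge that the configuration has not
chosen; the block of this edge then has another element, so that the part
already followed is an entry. *)
Lemma path_in_config x g l w : word g = l :: w -> last l w = (x, false) ->
  src x = v -> adm_word (word g) -> xi (g, drng l) \/ entry_in xi x.
Proof.
move=> + + sx; elim: w g l => [|m w IHw] g l wg lw aw;
  have [h [eg wh]] := word_cons_gen wg.
  left; move: lw => /= lw; rewrite eg lw.
  have -> : h = 1%g by apply: word_inj; rewrite wh.
  by apply: cfg_edge; rewrite // sx.
rewrite wg /adm_word /= in aw; case/andP: aw => aml aw.
have awh : adm_word (word h) by rewrite wh.
have {IHw awh}[xh|?] := IHw h m wh lw awh; last by right.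
rewrite /adm_step in aml; case/andP: aml => /eqP em.
case: l em eg wg lw => y []; case: m aw wh xh => z [];
  rewrite /dsrc /drng //= => aw wh xh em eg wg lw nzy.
  have [lt1|] := boolP (2 <= #|class_of y|).
    right; exists h, z, w, (class_of y); split=> //.
      by rewrite em class_of_cls.
    by rewrite eq_sym.
  rewrite -leqNgt => le1; left.
  rewrite em in xh.
  have [y' y'X y'h] := cfg_choice cxi (class_of_cls y) xh.
  suff ey : y' = y by rewrite eg -ey.
  by apply: (card_le1_eqP le1) => //; exact: mem_class_of.
by left; rewrite eg; apply: cfg_edge; rewrite // -em.
Qed.

(** A given entry need not lie in the configuration, but then it leaves it at a
place that is itself an entry. *)
Lemma has_entry_in : has_entry v -> exists2 x, src x = v & entry_in xi x.
Proof.
move=> [[x b] [q /= [aq nb nz sx [X [Xz nX cX]]]]]; exists x => //.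
case: b nb aq nz Xz nX => // _ aq nz Xz nX.
have [z [w [ew lw zX]]] : exists z w, [/\ rev ((x, false) :: q) = (z, false) :: w,
    last (z, false) w = (x, false) & X \in cls (rng z) /\ X != class_of z].
  case: (lastP q) nz Xz nX {aq} => [|q' [z b]]; first by exists x, [::].
  rewrite last_rcons /=; case: b => // _ Xz nX; exists z, (rcons (rev q') (x, false)).
  by rewrite rev_cons rev_rcons rcons_cons last_rcons.
have aw : adm_word ((z, false) :: w) by rewrite -ew adm_word_rev.
pose g : FE := FreeGroup (adm_word_reduced aw).
have [xg|//] := @path_in_config x g (z, false) w erefl lw sx aw.
by case: zX => {}Xz {}nX; exists g, z, w, X; split.
Qed.

End Paths.

(** * Closed paths under condition (L) *)

Section ClosedPaths.
Variable E : bipartite_sepgraph.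
Implicit Types (a b : dedge E) (p s : seq (dedge E)).

Lemma adm_alternate a p k : path (@adm_step E) a p -> k <= size p ->
  (nth a (a :: p) k).2 = a.2 (+) odd k.
Proof.
elim: k => [|k IHk] ap kp /=; first by rewrite addbF.
rewrite addbN -(IHk ap (ltnW kp)); have := pathP a ap k kp.
by case/andP=> _; case: (nth a (a :: p) k).2; case: (nth a p k).2.
Qed.

(** Two distinct edges of a block make any edge of another block an entry. *)
Lemma entry_edge (x f g : edge E) : f != g -> class_of f = class_of g ->
  rng f = rng x -> class_of x != class_of f -> has_entry (src x).
Proof.
move=> nfg efg rf nxf; exists (x, false), [::]; split=> //=.
exists (class_of f); split.
- by rewrite -rf class_of_cls.
- by rewrite eq_sym.
- rewrite (cardsD1 f) mem_class_of (cardsD1 g) !inE eq_sym nfg efg mem_class_of.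
  by rewrite addnA leq_addr.
Qed.

(** By induction on the length.  If e_1 <> e_2r, the closed path is a cycle, to
which (L) applies, or it contains a shorter closed path.  If e_1 = e_2r = e, the
path goes along e, turns around a closed path c based at r(e), and comes back.
Let f^* and g be the first and last letters of c.  If f = g, then c is again
made of a shorter closed path and its way back.  If f and g are distinct edges
of the same block, then e is an entry.  Otherwise, c can be started after its
first letter, which gives a shorter closed path. *)
Lemma closed_path_entry : conditionL E -> forall a p, closed_path a p ->
  exists2 b, b \in a :: p & has_entry (src b.1).
Proof.
move=> L a p; have [n] := ubnP (size p); elim: n a p => // n IHn a p sp cl.
have [ap na lp salp] := cl.
have [e1r|ne1r] := eqVneq a.1 (last a p).1; last first.
  have [cyc|ncyc] := pselect (graph_cycle a p).
    have [x [q [ax nx nq sx [X HX]]]] := L _ _ cyc.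
    exists a; first by rewrite inE eqxx.
    by exists x, q; split=> //; exists X.
  have [i [j [i1 ij jr eij]]] : exists i j, [/\ 0 < i, i <= j,
      j < (size (a :: p))./2 &
      src (edge_at a p (2 * i - 1)) = src (edge_at a p (2 * j))].
    apply: contrapT => H; apply: ncyc; split=> //.
      have -> : (2 * (size (a :: p))./2 = size (a :: p))%N.
        have := adm_alternate ap (leqnn _); rewrite nth_last lp (negPf na) /=.
        by move=> /esym; lia.
      by rewrite /edge_at nth_last /= => /eqP; apply/negP.
    by move=> i j i1 ij jr eij; apply: H; exists i, j.
  pose s := drop (2 * i - 2) (take (2 * j) (a :: p)).
  have ss : size s = (2 * j - 2 * i + 2)%N.
    by rewrite size_drop size_take_min; lia.
  have nths k : k < size s -> nth a s k = nth a (a :: p) (k + (2 * i - 2)).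
    move=> ks; rewrite nth_drop nth_take addnC//; lia.
  have [b [q eq_s]] : exists b q, s = b :: q.
    by move: ss; case: (s) => [/=|b q _]; [lia | exists b, q].
  have sub c : c \in b :: q -> c \in a :: p.
    by rewrite -eq_s => /mem_drop /mem_take.
  have b_nth : b = nth a (a :: p) (2 * i - 2).
    by have := nths 0%N; rewrite ss eq_s /= add0n; apply; lia.
  have l_nth : last b q = nth a (a :: p) (2 * j - 1).
    have := nths (size s).-1; rewrite nth_last eq_s /=.
    rewrite eq_s /= in ss; move=> -> //; congr nth; lia.
  have [||c] := IHn b q.
  + rewrite eq_s /= in ss; rewrite /= in jr; lia.
  + split.
    - have : sorted (@adm_step E) s by apply/drop_sorted/take_sorted.
      by rewrite eq_s.
    - have ip : 2 * i - 2 <= size p by move: jr => /=; lia.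
      rewrite b_nth (adm_alternate ap ip) (negPf na) /=.
      by have -> : (2 * i - 2 = (i.-1).*2)%N by [lia]; rewrite odd_double.
    - have jp : 2 * j - 1 <= size p by move: jr => /=; lia.
      rewrite [last _ _]l_nth (adm_alternate ap jp) (negPf na) /=.
      have -> : (2 * j - 1 = (j.-1).*2.+1)%N by lia.
      by rewrite /= odd_double.
    - rewrite [last _ _]l_nth b_nth; move: eij; rewrite /edge_at.
      have -> : 2 * i - 2 = (2 * i - 1).-1 by lia.
      by have -> : 2 * j - 1 = (2 * j).-1 by lia.
  by move=> cs ?; exists c => //; apply: sub.
case: a na e1r salp {cl} ap lp sp => e [] //= _ e1r _ ap lp sp.
case/lastP: p ap e1r lp sp => [|p [e' b]] //.
rewrite last_rcons /admissible rcons_path /= => /andP[ap lpe] ee' bT sp.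
case: b lpe bT sp => // lpe _ sp; rewrite -{e'}ee' in lpe sp *.
case: p ap lpe sp => [|[f b] p] /=.
  by move=> _ /andP[_]; rewrite /= eqxx.
move=> /andP[/andP[/= erf nef] ap] lpe sp.
case: b erf nef ap lpe sp => //= erf nef ap lpe sp.
case/lastP: p ap lpe sp => [|p [g b]].
  by move=> _; rewrite /adm_step /= andbF.
rewrite rcons_path last_rcons size_rcons => /andP[ap lpg] /andP[/= erg nge] sp.
case: b lpg erg nge sp => //= lpg erg nge sp.
rewrite /drng /dsrc /= in erf erg.
have mem_sub c : c \in p -> c \in [:: (e, false), (f, true)
    & rcons (rcons p (g, false)) (e, true)].
  by move=> cp; rewrite !(inE, mem_rcons) cp !orbT.
have [efg|nfg] := eqVneq f g.
  case: p ap lpg sp mem_sub => [|[h b] p] /=.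
    by rewrite /adm_step /= efg eqxx andbF.
  case: b => [|/andP[/andP[sfh nfh] ap]]; first by rewrite /adm_step andbF.
  have [[k bk] lk] : exists kb, last ((h, false) : dedge E) p = kb by eexists.
  rewrite lk /adm_step /=; case: bk lk => lk; last by rewrite andbF.
  move=> /andP[skg nkg] sp sub; rewrite /dsrc /drng /= in sfh skg.
  have [||c cp ec] := IHn (h, false) p.
  - by move: sp; rewrite !size_rcons /=; lia.
  - split; rewrite ?lk//=; rewrite -(eqP sfh); first by rewrite efg -(eqP skg).
  by exists c; first exact: sub.
have [cfg|ncfg] := eqVneq (class_of f) (class_of g).
  exists (e, false); first by rewrite inE eqxx.
  by apply: (entry_edge nfg cfg) => //; rewrite -(eqP erf).
have step : adm_step (g, false) (f, true).
  apply/andP; split; last by rewrite /= eq_sym.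
  by rewrite /drng /dsrc /= (eqP erg) -(eqP erf).
have [c cl sub] : exists2 c, c = head (g, false) p &
    closed_path c (behead (rcons (rcons p (g, false)) (f, true))).
  exists (head (g, false) p) => //; case: p ap lpg {sp mem_sub} => [|[h b] p] /=.
    move=> _ /andP[/= sfg _]; split=> //=; first by rewrite step.
    by move: sfg; rewrite /dsrc /drng /= => /eqP ->.
  move=> /andP[/andP[sfh nfh] ap] lpg; split=> //=.
  - by rewrite /admissible !rcons_path ap lpg last_rcons step.
  - by case: b nfh {sfh ap lpg}.
  - by rewrite last_rcons.
  - by rewrite last_rcons /=; case: b sfh nfh {ap lpg} => // /eqP.
have ecp : c :: behead (rcons (rcons p (g, false)) (f, true)) =
    rcons (rcons p (g, false)) (f, true).
  by rewrite cl; case: (p).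
have [|d ds ed] := IHn c _ _ sub.
- by rewrite size_behead !size_rcons /=; move: sp; rewrite !size_rcons /=; lia.
exists d => //; move: ds; rewrite ecp !(inE, mem_rcons).
by move=> /or3P[] ->; rewrite ?orbT.
Qed.

End ClosedPaths.

(** * The dynamical system of all configurations *)

Section TreeSpace.
Local Open Scope classical_set_scope.
Variable E : bipartite_sepgraph.
Local Notation FE := (free_group (edge E)).
Local Notation coord := (FE * vert E)%type.
Implicit Types (g h : FE) (x y : edge E) (u v : vert E).

Definition config_set : set (prod_topology (fun _ : coord => bool)) :=
  [set xi | is_config xi].

Definition tree_space : topologicalType := set_type config_set.

Definition config_val (t : tree_space) : coord -> bool := \val t.

Lemma config_valP t : is_config (config_val t).
Proof. by have := valP t; rewrite inE. Qed.

Definition mk_tree xi (cxi : is_config xi) : tree_space :=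
  SigSub (mem_set cxi : xi \in config_set).

Lemma mk_treeK xi (cxi : is_config xi) : config_val (mk_tree cxi) = xi.
Proof. by []. Qed.

Lemma config_val_inj : injective config_val.
Proof. by move=> s t; apply: val_inj. Qed.

Lemma config_val_continuous i : continuous (fun t : tree_space => config_val t i).
Proof.
move=> t; apply: (@continuous_comp _ _ _ (fun t : tree_space => \val t) (proj i)).
  exact: initial_continuous.
exact: proj_continuous.
Qed.

Lemma coord_clopen i : clopen [set t : tree_space | config_val t i].
Proof.
have -> : [set t : tree_space | config_val t i] =
   (fun t : tree_space => config_val t i) @^-1` [set true] by [].
apply: preimage_clopen; last exact: config_val_continuous.
by split; [exact: discrete_open | exact: discrete_closed].
Qed.

(** The topology is induced by a product of discrete spaces, so the filter only
has to fix each coordinate. *)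
Lemma tree_cvg (F : set_system tree_space) (t : tree_space) : Filter F ->
  (forall i, F [set s | config_val s i = config_val t i]) -> F --> t.
Proof.
move=> FF Ft A [B [[U oU <-] Ut sub]]; rewrite nbhs_simpl.
apply: filterS sub _.
have : (fun s : tree_space => \val s) @ F --> (\val t : prod_topology _).
  apply/cvg_sup => i V' [V] [[W] oW <-] Wt WU.
  suff : F [set s : tree_space | V' (\val s)] by [].
  apply: filterS (Ft i) => s /= si; apply: WU.
  by change (W (config_val s i)); rewrite si.
by apply; apply: open_nbhs_nbhs.
Qed.

Lemma tree_hausdorff : hausdorff_space tree_space.
Proof.
rewrite open_hausdorff => s t nst.
have [i nsti] : exists i, config_val s i != config_val t i.
  apply: contrapT => H; move/eqP: nst; apply; apply: config_val_inj.
  by apply: funext => i; apply/eqP; apply: contrapT => ni; apply: H; exists i; apply/negP.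
have [oi ci] := coord_clopen i.
have [si|si] := boolP (config_val s i).
  exists ([set t | config_val t i], ~` [set t | config_val t i]) => /=.
    by split; rewrite inE //= => ti; move: nsti; rewrite si ti.
  by split=> //; [exact: closed_openC | apply/eqP; exact: setICr].
exists (~` [set t | config_val t i], [set t | config_val t i]) => /=.
  split; rewrite inE /=; first exact/negP.
  by move: nsti; rewrite (negPf si) eq_sym eqbF_neg negbK.
by split=> //; [exact: closed_openC | apply/eqP; exact: setICl].
Qed.

(** The limit along an ultrafilter is taken coordinatewise.  It is a
configuration because each of the conditions involves finitely many
coordinates, on which the limit agrees with some configuration. *)
Lemma tree_compact : compact [set: tree_space].
Proof.
rewrite compact_ultra => F FU _.
pose xi : coord -> bool := fun i => `[< F [set s | config_val s i] >].
have Fxi i : F [set s | config_val s i = xi i].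
  rewrite /xi; have [Fi|Fi] := pselect (F [set s | config_val s i]).
    by rewrite asboolT//; apply: filterS Fi.
  have [//|] := in_ultra_setVsetC [set s | config_val s i] FU.
  by rewrite asboolF//; apply: filterS => s /= /negP/negbTE.
have Fex (l : seq coord) : exists t, forall i, i \in l -> config_val t i = xi i.
  have : F [set s | forall i, i \in l -> config_val s i = xi i].
    elim: l => [|i l IHl]; first by apply: filterS filterT => s.
    apply: filterS (filterI (Fxi i) IHl) => s /= [si sl] j.
    by rewrite inE => /predU1P[->|/sl].
  by move=> /filter_ex.
have cxi : is_config xi.
  split.
  - have [t et] := Fex [seq (1%g, v) | v <- enum (vert E)].
    have [v v1] := cfg_root (config_valP t); exists v; rewrite -et//.
    by apply/mapP; exists v; rewrite ?mem_enum.
  - move=> g u v; have [t et] := Fex [:: (g, u); (g, v)].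
    by rewrite -!et ?inE ?eqxx ?orbT//; apply: cfg_fun (config_valP t) _ _ _.
  - move=> g x; have [t et] := Fex [:: (g, src x); (gen (x, false) * g, rng x)%g].
    by rewrite -!et ?inE ?eqxx ?orbT//; apply: cfg_edge (config_valP t) _ _.
  - move=> g v X Xv.
    pose nbrs := [seq (gen (x, true) * g, src x)%g | x <- enum (edge E)].
    have [t et] := Fex ((g, v) :: nbrs).
    rewrite -et ?inE ?eqxx// => /(cfg_choice (config_valP t) Xv)[x xX xg].
    exists x; rewrite -?et// inE; apply/orP; right; apply/mapP.
    by exists x; rewrite ?mem_enum.
  - move=> g x y exy.
    have [t et] := Fex [:: (gen (x, true) * g, src x)%g;
                           (gen (y, true) * g, src y)%g].
    by rewrite -!et ?inE ?eqxx ?orbT//; apply: cfg_choice_uniq (config_valP t) _ _ _ exy.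
  - move=> g l h u wg; have [t et] := Fex [:: (g, u); (h, dsrc l)].
    by rewrite -!et ?inE ?eqxx ?orbT//; apply: cfg_tree (config_valP t) _ _ _ _ wg.
by exists (mk_tree cxi); split=> //; apply: tree_cvg => i; apply: Fxi.
Qed.

(** The value outside the domain is arbitrary. *)
Definition tree_act (m : letter (edge E)) (t : tree_space) : tree_space :=
  if pselect (config_val t (gen m, drng m)) is left tm
  then mk_tree (reroot_config (config_valP t) tm) else t.

Lemma tree_actE (m : letter (edge E)) t i : config_val t (gen m, drng m) ->
  config_val (tree_act m t) i = config_val t (i.1 * gen m, i.2)%g.
Proof. by move=> tm; rewrite /tree_act; case: pselect. Qed.

Lemma config_gen_edge t x :
  config_val t (gen (x, false), rng x) = config_val t (1%g, src x).
Proof.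
apply/idP/idP => [tx|]; last first.
  by move=> /(cfg_edge (config_valP t)); rewrite mulg1.
by have [] := @cfg_tree _ _ (config_valP t) (gen (x, false)) (x, false) 1%g _ erefl tx.
Qed.

Lemma tree_actK (m : letter (edge E)) t : config_val t (gen m, drng m) ->
  config_val (tree_act m t) (gen (letter_inv m), drng (letter_inv m)) /\
  tree_act (letter_inv m) (tree_act m t) = t.
Proof.
move=> tm; have H : config_val (tree_act m t) (gen (letter_inv m), drng (letter_inv m)).
  rewrite tree_actE//= -genV mulVg drng_inv.
  by have [] := @cfg_tree _ _ (config_valP t) (gen m) m 1%g _ erefl tm.
split=> //; apply: config_val_inj; apply: funext => -[g u].
by rewrite tree_actE// tree_actE//= -genV -mulgA mulVg mulg1.
Qed.

Lemma tree_act_continuous (m : letter (edge E)) :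
  {within [set t | config_val t (gen m, drng m)], continuous (tree_act m)}.
Proof.
rewrite continuous_open_subspace; last by case: (coord_clopen (gen m, drng m)).
move=> t; rewrite inE /= => tm; 
have FF : Filter (tree_act m @ t) by exact/fmap_filter/(nbhs_filter t).
apply: (tree_cvg FF) => i.
have [oA _] := coord_clopen (gen m, drng m).
have Am : \forall s \near t, config_val s (gen m, drng m).
  exact: (open_nbhs_nbhs (conj oA tm)).
have Ai : \forall s \near t,
    config_val s (i.1 * gen m, i.2)%g = config_val t (i.1 * gen m, i.2)%g.
  have := @config_val_continuous (i.1 * gen m, i.2)%g t.
  by move=> /(_ [set config_val t (i.1 * gen m, i.2)%g]); apply; exact: discrete_set1.
by apply: filterS2 Am Ai => s /= sm si; rewrite !tree_actE.
Qed.

Lemma tree_act_homeo x : homeo_on [set t | config_val t (1%g, src x)]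
  [set t | config_val t (gen (x, true), src x)]
  (tree_act (x, false)) (tree_act (x, true)).
Proof.
have -> : [set t | config_val t (1%g, src x)] =
    [set t : tree_space | config_val t (gen (x, false), rng x)].
  by apply/seteqP; split=> t /=; rewrite config_gen_edge.
split.
- by move=> t /= /(@tree_actK (x, false))[].
- by move=> t /= /(@tree_actK (x, true))[].
- by move=> t /= /(@tree_actK (x, false))[].
- by move=> t /= /(@tree_actK (x, true))[].
- exact: (@tree_act_continuous (x, false)).
- exact: (@tree_act_continuous (x, true)).
Qed.

Definition tree_system : dyn_system E.
Proof.
refine (@DynSystem E tree_space tree_compact tree_hausdorff
  (fun v => [set t | config_val t (1%g, v)]) (fun v => coord_clopen (1%g, v)) _ _
  (fun x => [set t | config_val t (gen (x, true), src x)])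
  (fun x => coord_clopen (gen (x, true), src x)) _ _ _
  (fun x => tree_act (x, false)) (fun x => tree_act (x, true)) tree_act_homeo).
- apply/seteqP; split=> // t _; have [v tv] := cfg_root (config_valP t).
  by exists v.
- by move=> u v _ _ [t [/= tu tv]]; apply: cfg_fun (config_valP t) _ _ _ tu tv.
- move=> x t /= tx; apply: (config_rng (config_valP t)).
  by rewrite mulg1.
- move=> v X _ Xv; apply/seteqP; split.
    move=> t [x /= xX tx]; rewrite -(cls_rng Xv xX).
    by apply: (config_rng (config_valP t)); rewrite mulg1.
  move=> t /= /(cfg_choice (config_valP t) Xv)[x xX]; rewrite mulg1 => tx.
  by exists x.
- move=> v X _ Xv x y /= xX yX [t [/= tx ty]].
  apply: (cfg_choice_uniq (config_valP t) (g := 1%g)); rewrite ?mulg1//.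
  by rewrite !(cls_class Xv).
Defined.

End TreeSpace.

(** * The configuration of a point *)

Section SystemConfig.
Local Open Scope classical_set_scope.
Variables (E : bipartite_sepgraph) (T : dyn_system E).
Local Notation FE := (free_group (edge E)).
Local Notation coord := (FE * vert E)%type.
Implicit Types (g h : FE) (x y : edge E) (u v : vert E) (p : T).

Local Notation dom g := (@word_dom E T (word g%g)).
Local Notation fn g := (@word_fun E T (word g%g)).

Definition config_of p : coord -> bool :=
  fun i => `[< dom i.1 p /\ ds_part T i.2 (fn i.1 p) >].

Lemma part_inj u v p : ds_part T u p -> ds_part T v p -> u = v.
Proof. by move=> up vp; apply: (@ds_part_triv E T u v I I); exists p. Qed.

Lemma part_ex p : exists v, ds_part T v p.
Proof.
have : (\bigcup_(v in [set: vert E]) ds_part T v) p by rewrite ds_part_cover.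
by case=> v _ vp; exists v.
Qed.

Lemma letter_dom_part (l : letter (edge E)) p :
  @letter_dom E T l p -> ds_part T (dsrc l) p.
Proof. by case: l => x [] //; apply: ds_image_sub. Qed.

Lemma letter_fun_part (l : letter (edge E)) p :
  @letter_dom E T l p -> ds_part T (drng l) (@letter_fun E T l p).
Proof.
move=> lp; rewrite -dsrc_inv; apply: letter_dom_part.
exact: homeo_fun (@letter_homeo E T l) _ lp.
Qed.

(** The domain of theta_{gh} may be larger than that of theta_g theta_h, but
not at points where theta_h is defined. *)
Lemma dom_mul g h p : dom h p -> dom (g * h) p <-> dom g (fn h p).
Proof.
move=> hp; split; last by move=> gp; have [] := word_mul_act hp gp.
move=> ghp; have [hVq hK] := word_inv_act hp.
have := @word_mul_act _ _ (word (g * h)%g) (word h^-1%g) _ hVq.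
by rewrite hK => /(_ ghp)[+ _]; rewrite -[word_mul _ _]/(word (g * h * h^-1)%g) mulgK.
Qed.

Lemma fn_mul g h p : dom h p -> dom (g * h) p -> fn (g * h) p = fn g (fn h p).
Proof. by move=> hp /(dom_mul _ hp) gp; have [] := word_mul_act hp gp. Qed.

Lemma config_of_act h p : dom h p -> config_of (fn h p) = reroot h (config_of p).
Proof.
move=> hp; apply: funext => -[g u]; rewrite /config_of /reroot /=.
apply: asbool_equiv_eq; split=> -[].
  by move=> /(dom_mul _ hp) ghp; rewrite -fn_mul.
by move=> ghp; rewrite fn_mul//; split=> //; apply/dom_mul.
Qed.

Lemma config_ofP p g u :
  reflect (dom g p /\ ds_part T u (fn g p)) (config_of p (g, u)).
Proof. exact: asboolP. Qed.

Lemma config_of_is_config p : is_config (config_of p).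
Proof.
have edgeP g x : config_of p (g, src x) -> config_of p (gen (x, false) * g, rng x)%g.
  move=> /config_ofP[gp sp]; apply/config_ofP.
  have xgp : dom (gen (x, false) * g) p by apply/(dom_mul _ gp).
  split=> //; rewrite fn_mul//.
  exact: (@letter_fun_part (x, false)).
have imgP g x : config_of p (gen (x, true) * g, src x)%g ->
    dom g p /\ ds_image T x (fn g p).
  move=> /[dup] /edgeP; rewrite genVK => /config_ofP[gp _].
  by move=> /config_ofP[/(dom_mul _ gp)[]].
split.
- by have [v pv] := part_ex p; exists v; apply/asboolP.
- by move=> g u v /config_ofP[_ up] /config_ofP[_]; apply: part_inj.
- exact: edgeP.
- move=> g v X Xv /config_ofP[gp vp].
  have [x0 x0X] := cls_neq0 Xv.
  have v0 : v \in vert0 E by rewrite -(cls_rng Xv x0X) rng_vert0.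
  move: vp; rewrite -(ds_image_cover T v0 Xv) => -[x xX xp].
  exists x => //; apply/config_ofP.
  have xgp : dom (gen (x, true) * g) p by apply/(dom_mul _ gp).
  split=> //; rewrite fn_mul//.
  exact: (@letter_fun_part (x, true)).
- move=> g x y exy /imgP[_ xp] /imgP[_ yp].
  have yX : y \in class_of x by rewrite exy mem_class_of.
  apply: (@ds_image_triv E T _ _ (rng_vert0 x) (class_of_cls x) x y) => //.
    exact: mem_class_of.
  by exists (fn g p).
- move=> g l h u wg /config_ofP[]; rewrite wg /= => -[hp lp] up; split.
    by apply/config_ofP; split=> //=; apply: letter_dom_part.
  exact: part_inj up (letter_fun_part lp).
Qed.

Lemma letter_preimage_open (l : letter (edge E)) (A : set T) : open A ->
  open (@letter_dom E T l `&` @letter_fun E T l @^-1` A).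
Proof.
move=> oA; rewrite openE => p [lp Ap]; apply: filterI.
  by apply: open_nbhs_nbhs; split=> //; apply: letter_dom_open.
by apply: (letter_fun_cont lp); apply: open_nbhs_nbhs.
Qed.

Lemma letter_preimage_clopen (l : letter (edge E)) (A : set T) : clopen A ->
  clopen (@letter_dom E T l `&` @letter_fun E T l @^-1` A).
Proof.
move=> [oA cA]; split; first exact: letter_preimage_open.
rewrite -openC setCI.
have -> : ~` @letter_dom E T l `|` ~` (@letter_fun E T l @^-1` A) =
    ~` @letter_dom E T l `|` (@letter_dom E T l `&` @letter_fun E T l @^-1` (~` A)).
  by rewrite setUIr setUCl setTI.
apply: openU; last by apply: letter_preimage_open; apply: closed_openC.
apply: closed_openC; rewrite /letter_dom; case: ifP => _.
  by have [] := ds_image_clopen T l.1.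
by have [] := ds_part_clopen T (src l.1).
Qed.

(** This makes each coordinate of the configuration continuous. *)
Lemma word_preimage_clopen w (A : set T) : clopen A ->
  clopen (@word_dom E T w `&` @word_fun E T w @^-1` A).
Proof.
elim: w A => [|l w IHw] A cA /=; first by rewrite setTI.
rewrite -setIA; exact: IHw (letter_preimage_clopen l cA).
Qed.

Lemma config_of_clopen i : clopen [set p | config_of p i].
Proof.
have -> : [set p | config_of p i] = dom i.1 `&` fn i.1 @^-1` (ds_part T i.2).
  by apply/seteqP; split=> p /= /asboolP.
by apply: word_preimage_clopen; apply: ds_part_clopen.
Qed.

Definition orbit_tree p : tree_space E := mk_tree (config_of_is_config p).

Lemma orbit_tree_continuous : continuous orbit_tree.
Proof.
move=> p; have FF : Filter (orbit_tree @ p).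
  exact: (fmap_filter orbit_tree (nbhs_filter p)).
apply: (tree_cvg FF) => i.
have [oi ci] := config_of_clopen i.
suff : \forall q \near p, config_of q i = config_of p i by [].
have [pi|pi] := boolP (config_of p i).
  by apply: filterS (open_nbhs_nbhs (conj oi pi)) => q.
have oic := closed_openC ci.
apply: filterS (open_nbhs_nbhs (conj oic (negP pi))) => q /= /negP /negbTE ->.
by [].
Qed.

Lemma orbit_tree_equivariant : @equivariant E T (tree_system E) orbit_tree.
Proof.
split.
- by move=> w _ [p wp <-]; apply/asboolP.
- move=> x _ [p xp <-]; apply/asboolP; split=> //=.
  exact: (@letter_fun_part (x, true)).
- move=> x p sp; apply: config_val_inj; apply: funext => -[g u].
  have xp : dom (gen (x, false)) p by split.
  rewrite tree_actE/=; last first.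
    by apply/asboolP; split=> //; apply: (@letter_fun_part (x, false)).
  by rewrite mk_treeK -[LHS]/(config_of (fn (gen (x, false)) p) (g, u)) config_of_act.
Qed.

End SystemConfig.

(** * Universal systems and configurations *)

Section Equivariance.
Local Open Scope classical_set_scope.
Variable E : bipartite_sepgraph.
Local Notation FE := (free_group (edge E)).

Section EquivariantMap.
Variables (S T : dyn_system E) (f : S -> T).
Hypothesis ef : equivariant f.

(** An equivariant map sends the pieces of a partition into the pieces of a
partition with the same index, so it also reflects membership. *)
Lemma equiv_part_iff v p : ds_part T v (f p) <-> ds_part S v p.
Proof.
split=> [vfp|vp]; last by apply: (equiv_part ef); exists p.
have [u up] := part_ex p.
suff -> : v = u by [].
by apply: part_inj vfp _; apply: (equiv_part ef); exists p.
Qed.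

Lemma equiv_letter_dom l p : @letter_dom E T l (f p) <-> @letter_dom E S l p.
Proof.
case: l => x []; rewrite /letter_dom /=; last exact: equiv_part_iff.
split=> [xfp|xp]; last by apply: (equiv_image ef); exists p.
have : ds_part S (rng x) p by apply/equiv_part_iff/ds_image_sub.
rewrite -(ds_image_cover S (rng_vert0 x) (class_of_cls x)) => -[y yX yp].
suff -> : x = y by [].
apply: (@ds_image_triv E T _ _ (rng_vert0 x) (class_of_cls x) x y) => //.
  exact: mem_class_of.
by exists (f p); split=> //; apply: (equiv_image ef); exists p.
Qed.

Lemma equiv_letter_fun l p : @letter_dom E S l p ->
  f (@letter_fun E S l p) = @letter_fun E T l (f p).
Proof.
case: l => x []; rewrite /letter_dom /letter_fun /= => xp; last exact: (equiv_map ef).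
have hS := ds_map_homeo S x; have hT := ds_map_homeo T x.
have sq : ds_part S (src x) (ds_mapV S x p) := homeo_inv hS xp.
rewrite -[in RHS](homeoVK hS xp) (equiv_map ef)// (homeoK hT)//.
exact/equiv_part_iff.
Qed.

Lemma equiv_word w p : (@word_dom E T w (f p) <-> @word_dom E S w p) /\
  (@word_dom E S w p -> f (@word_fun E S w p) = @word_fun E T w (f p)).
Proof.
elim: w => [|l w [IHd IHf]] //=; split.
  split=> [[/IHd wp lp]|[wp lp]]; split=> //.
  - by apply/equiv_letter_dom; rewrite IHf.
  - exact/IHd.
  - by rewrite /preimage /= -IHf//; apply/equiv_letter_dom.
by move=> [wp lp]; rewrite equiv_letter_fun// IHf.
Qed.

Lemma equiv_config p : config_of (f p) = config_of p.
Proof.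
apply: funext => -[g u]; apply: asbool_equiv_eq => /=.
have [d e] := equiv_word (word g) p.
split=> -[gp up].
  by have gp' := gp; move/d: gp' => gp'; split=> //; apply/equiv_part_iff; rewrite e.
by split; [apply/d|rewrite -e//; apply/equiv_part_iff].
Qed.

End EquivariantMap.

Lemma tree_letter_dom l (t : tree_system E) :
  @letter_dom E (tree_system E) l t <-> config_val t (gen l, drng l).
Proof.
by case: l => x []; rewrite /letter_dom //=; rewrite config_gen_edge.
Qed.

Lemma tree_letter_fun l : @letter_fun E (tree_system E) l = tree_act l.
Proof. by case: l => x []. Qed.

Lemma tree_word (g : FE) (t : tree_system E) :
  (@word_dom E (tree_system E) (word g) t <-> exists u, config_val t (g, u)) /\
  (@word_dom E (tree_system E) (word g) t ->
    config_val (@word_fun E (tree_system E) (word g) t) = reroot g (config_val t)).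
Proof.
move: {2}(word g) (erefl (word g)) => w; elim: w g => [|l w IHw] g wg.
  have -> : g = 1%g by apply: word_inj; rewrite wg.
  split; first by split=> // _; apply: cfg_root (config_valP t).
  by move=> _; apply: funext => -[h u]; rewrite /reroot /= mulg1.
have [h [eg wh]] := word_cons_gen wg; have [IHd IHf] := IHw h wh.
have domE : @word_dom E (tree_system E) (word g) t <->
    @word_dom E (tree_system E) (word h) t /\ config_val t (g, drng l).
  rewrite wg wh /= /preimage /=.
  split=> -[hp]; rewrite -wh in hp *.
    by move=> /tree_letter_dom; rewrite IHf// /reroot /= -eg.
  move=> gp; split=> //; apply/tree_letter_dom.
  by rewrite IHf// /reroot /= -eg.
split.
  split=> [/domE[_ gp]|[u gp]]; first by exists (drng l).
  have wg' : word g = l :: word h by rewrite wh.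
  have [hp eu] := cfg_tree (config_valP t) wg' gp.
  by apply/domE; split; [apply/IHd; exists (dsrc l) | rewrite -eu].
move=> /domE[hp gp]; rewrite wg /= tree_letter_fun -wh.
apply: funext => -[k u]; rewrite tree_actE IHf// /reroot /= -?eg//.
by rewrite -mulgA -eg.
Qed.

Lemma config_of_tree (t : tree_system E) : config_of t = config_val t.
Proof.
apply: funext => -[g u]; have [d e] := tree_word g t.
apply/asboolP/idP => /=.
  by move=> [gp]; rewrite /= e// /reroot /= mul1g.
move=> tg; have gp : @word_dom E (tree_system E) (word g) t by apply/d; exists u.
by split=> //; rewrite /= e// /reroot /= mul1g.
Qed.

(** The composite of [orbit_tree] and of the universal map is an equivariant
endomorphism of Omega, hence the identity.  The other composite is the identity
because equivariant maps preserve configurations. *)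
Lemma universal_retract (Omega : dyn_system E) : universal_system Omega ->
  exists f : tree_space E -> Omega, [/\ continuous f,
    forall p, f (orbit_tree p) = p &
    forall t, config_of (f t) = config_val t].
Proof.
move=> univ; have [f [[cf ef] _]] := univ (tree_system E).
exists f; split=> //; last by move=> t; rewrite (equiv_config ef) config_of_tree.
have [i [_ ui]] := univ Omega.
have id_eq : i = id.
  apply: ui; split; first by move=> p; apply: cvg_id.
  by split=> [w _ [p wp <-]|x _ [p xp <-]|].
have fc_eq : i = f \o @orbit_tree E Omega.
  apply: ui; split.
    by move=> p; apply: continuous_comp; [exact: orbit_tree_continuous | exact: cf].
  have ec := orbit_tree_equivariant Omega.
  split.
  - move=> w _ [p wp <-]; apply: (equiv_part ef); exists (orbit_tree p) => //.
    by apply: (equiv_part ec); exists p.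
  - move=> x _ [p xp <-]; apply: (equiv_image ef); exists (orbit_tree p) => //.
    by apply: (equiv_image ec); exists p.
  - move=> x p sp; rewrite /= (equiv_map ec)// (equiv_map ef)//.
    by apply: (equiv_part ec); exists p.
by move=> p; have := congr1 (@^~ p) fc_eq; rewrite id_eq /= => <-.
Qed.

End Equivariance.

(** * Closed paths and open sets of fixed points *)

Section Freeness.
Local Open Scope classical_set_scope.
Variables (E : bipartite_sepgraph) (T : dyn_system E).
Hypothesis univ : universal_system T.
Local Notation FE := (free_group (edge E)).
Implicit Types (g h t : FE) (x y z : edge E) (u v : vert E) (p : T).

Local Notation dom g := (@word_dom E T (word g%g)).
Local Notation fn g := (@word_fun E T (word g%g)).

Lemma config_of1 p v : config_of p (1%g, v) <-> ds_part T v p.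
Proof. by split=> [/config_ofP[]|?] //; apply/config_ofP. Qed.

Lemma universal_inj p q : config_of p = config_of q -> p = q.
Proof.
have [f [_ fK _]] := universal_retract univ => epq.
by rewrite -(fK p) -(fK q); congr f; apply: config_val_inj; rewrite !mk_treeK.
Qed.

(** Any policy grows a configuration rooted at [v]. *)
Lemma part_nonempty v : ds_part T v !=set0.
Proof.
have [f [_ _ cf]] := universal_retract univ.
have ct := tree_config_is_config (policy_of_policy (fun _ _ => None)) v.
exists (f (mk_tree ct)); apply/config_of1; rewrite cf mk_treeK.
by rewrite /tree_config /= eqxx.
Qed.

Section NoEntry.
Variables (v : vert E) (v1 : v \in vert1 E).
Hypothesis noentry : ~ has_entry v.

Lemma forced_path p g l w : ds_part T v p -> word g = l :: w ->
  ~~ (last l w).2 -> dsrc (last l w) = v -> adm_word (word g) ->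
  config_of p (g, drng l).
Proof.
move=> vp wg; case elw: (last l w) => [x []] // _ sx aw.
have cp := config_of_is_config p; have xi1 := (config_of1 p v).2 vp.
have [//|en] := path_in_config cp xi1 wg elw sx aw.
by case: noentry; apply: entry_in_has_entry en.
Qed.

(** Without entry, a configuration rooted at [v] contains all admissible paths
from [v], and nothing else. *)
Lemma part_singleton p q : ds_part T v p -> ds_part T v q -> p = q.
Proof.
have sub p' q' i : ds_part T v p' -> ds_part T v q' -> config_of p' i -> config_of q' i.
  case: i => g u vp vq; case wg: (word g) => [|l w].
    have -> : g = 1%g by apply: word_inj; rewrite wg.
    by move=> /config_of1 up; apply/config_of1; rewrite (part_inj up vp).
  move=> gp; have cp := config_of_is_config p'.
  have [aw l2 ls] := config_path cp ((config_of1 p' v).2 vp) v1 wg gp.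
  by rewrite (config_drng cp wg gp); apply: forced_path wg l2 ls aw.
move=> vp vq; apply: universal_inj; apply: funext => i.
by apply/idP/idP; apply: sub.
Qed.

End NoEntry.

Lemma top_free_conditionL : topologically_free (canonical_action T) -> conditionL E.
Proof.
move=> tf a s [[ap na ls ss] _ _]; apply: contrapT => noex.
have noentry : ~ has_entry (src a.1).
  by move=> [x [q [? ? ? ? [X HX]]]]; apply: noex; exists x, q; split=> //; exists X.
have v1 : src a.1 \in vert1 E by apply: src_vert1.
have aw : adm_word (rev (a :: s)) by rewrite adm_word_rev.
pose g : FE := FreeGroup (adm_word_reduced aw).
have [w [wg lw]] : exists w, word g = last a s :: w /\ last (last a s) w = a.
  rewrite /= lastI rev_rcons; exists (rev (belast a s)); split=> //.
  by case: (s) => //= b s'; rewrite rev_cons last_rcons.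
have g1 : g <> 1%g by move=> g1; have := wg; rewrite g1.
have sub : ds_part T (src a.1) `<=` [set p | pa_dom (canonical_action T) g^-1%g p
    /\ pa_fun (canonical_action T) g p = p].
  move=> p vp /=; rewrite /canonical_dom invgK.
  have sa : dsrc (last (last a s) w) = src a.1.
    by rewrite lw /dsrc (negPf na).
  have nl : ~~ (last (last a s) w).2 by rewrite lw.
  have /config_ofP[gp] := forced_path v1 noentry vp wg nl sa aw.
  rewrite /drng ls -ss => gvp; split=> //.
  exact: part_singleton gvp vp.
have [p vp] := part_nonempty (src a.1).
have : interior [set p | pa_dom (canonical_action T) g^-1%g p
    /\ pa_fun (canonical_action T) g p = p] p.
  have [op _] := ds_part_clopen T (src a.1).
  by move: sub; rewrite (open_subsetE _ op); apply.
by rewrite (tf g g1).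
Qed.

Definition fixed_on t (U : set T) := forall p, U p -> dom t p /\ fn t p = p.

Definition fixes t v := exists U : set T,
  [/\ open U, U !=set0, U `<=` ds_part T v & fixed_on t U].

Lemma dom_suffix t w h p : word t = w ++ word h -> dom t p -> dom h p.
Proof. by move=> -> /(word_cat w (word h) p).1[]. Qed.

(** If t fixes U pointwise, then h t h^-1 fixes theta_h(U) pointwise; all of U is
in the domain of theta_h because h is a right part of t. *)
Lemma fixes_conj t v w l w' h : fixes t v -> word t = w ++ word h ->
  word h = l :: w' -> fixes (h * t * h^-1)%g (drng l).
Proof.
move=> [U [oU [p0 Up0] Uv Ut]] wt wh.
have Udom p : U p -> dom h p by move=> /Ut[/(dom_suffix wt)].
have K q : dom h^-1 q -> fn h (fn h^-1 q) = q.
  by move=> /word_inv_act[_]; rewrite -[word_inv _]/(word (h^-1)^-1%g) invgK.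
exists (dom h^-1 `&` fn h^-1 @^-1` U); split.
- rewrite openE => q [hq Uq]; apply: filterI.
    by apply: open_nbhs_nbhs; split=> //; apply: word_dom_open.
  by apply: (word_fun_cont hq); apply: open_nbhs_nbhs.
- have [hq eq] := word_inv_act (Udom _ Up0).
  by exists (fn h p0); split=> //; rewrite /preimage /= eq.
- move=> q [hq Uq]; have hp := Udom _ Uq.
  have [u up] := part_ex (fn h (fn h^-1 q)).
  have cq : config_of (fn h^-1 q) (h, u) by apply/config_ofP.
  by have := config_drng (config_of_is_config _) wh cq; rewrite K// in up *; move=> <-.
- move=> q [hq Uq]; have [tp ep] := Ut _ Uq; have hp := Udom _ Uq.
  have htp : dom (h * t) (fn h^-1 q) by apply/(dom_mul _ tp); rewrite ep.
  have htq : dom (h * t * h^-1) q by apply/(dom_mul _ hq).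
  by split=> //; rewrite fn_mul// fn_mul// ep K.
Qed.

Definition min_fixes t v := [/\ t <> 1%g, fixes t v &
  forall t' v', t' <> 1%g -> fixes t' v' -> size (word t) <= size (word t')].

(** Otherwise, conjugation by the last letter would shorten [t]. *)
Lemma min_fixes_cyc t v l w : min_fixes t v -> word t = l :: w ->
  l != letter_inv (last l w).
Proof.
move=> [t1 ft mint] wt; apply/negP => /eqP el.
case/lastP: w wt el => [|w m] wt.
  by move=> /= el; have := letter_inv_neq l; rewrite {1}el eqxx.
rewrite last_rcons => el.
have rw : reduced w.
  have := valP t; rewrite /= wt => /reduced_behead.
  by rewrite -cats1; apply: reduced_catl.
pose g : FE := FreeGroup rw.
have tE : (t = gen l * (g * gen m))%g.
  apply: word_gen_cons; rewrite wt; congr (_ :: _).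
  rewrite word_mul_cat /= cats1//.
  by have := valP t; rewrite /= wt => /reduced_behead.
have cj : (gen m * t * (gen m)^-1 = g)%g.
  by rewrite tE el -genV mulVKg mulgK.
have wm : word t = (l :: w) ++ word (gen m) by rewrite wt /= cats1.
have fg : fixes g (drng m).
  by rewrite -cj; apply: fixes_conj ft wm _.
have g1 : g <> 1%g.
  by move=> g1; apply: t1; rewrite tE g1 mul1g el -genV mulVg.
by have := mint _ _ g1 fg; rewrite wt /= size_rcons; lia.
Qed.

(** The conjugate is a cyclic permutation of the letters of [t], so its length is
still minimal. *)
Lemma min_fixes_conj t v w l w' h : min_fixes t v -> word t = w ++ word h ->
  word h = l :: w' -> min_fixes (h * t * h^-1)%g (drng l).
Proof.
move=> mt wt wh; have [t1 ft mint] := mt.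
have rw : reduced w.
  by have := valP t; rewrite /= wt; apply: reduced_catl.
pose k : FE := FreeGroup rw.
have tE : (t = k * h)%g.
  by apply: word_inj; rewrite word_mul_cat -?wt//; apply: (valP t).
have cj : (h * t * h^-1 = h * k)%g by rewrite tE mulgA mulgK.
have whk : size (word (h * k)%g) = size (word t).
  suff rhk : reduced (word h ++ w).
    by rewrite (@word_mul_cat _ h k rhk) wt !size_cat addnC.
  case: w wt rw {k tE cj} => [|a w] wt rw; first by rewrite cats0; apply: (valP h).
  have na := min_fixes_cyc mt wt; rewrite wh last_cat /= in na.
  have rh := valP h; rewrite /= wh lastI in rh.
  by rewrite wh [l :: w']lastI; apply: reduced_cat.
rewrite cj; split; last by move=> t' v'; rewrite whk; apply: mint.
- move=> hk1; apply: t1; apply: word_inj; apply/size0nil.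
  by rewrite -whk hk1.
- by rewrite -cj; apply: fixes_conj ft wt wh.
Qed.

Lemma min_fixes_ex t v : t <> 1%g -> fixes t v -> exists t' v', min_fixes t' v'.
Proof.
move=> t1 ft.
pose P n := `[< exists t v, [/\ t <> 1%g, fixes t v & size (word t) = n] >].
have exP : exists n, P n by exists (size (word t)); apply/asboolP; exists t, v.
case: (ex_minnP exP) => n /asboolP[t' [v' [t1' ft' sn]]] minn.
exists t', v'; split=> // t2 v2 t2n1 ft2; rewrite sn; apply: minn.
by apply/asboolP; exists t2, v2.
Qed.

Lemma min_fixes_vert1 t v : min_fixes t v ->
  exists t' v', min_fixes t' v' /\ v' \in vert1 E.
Proof.
move=> mt; have [t1 [U [_ [p Up] Uv Ut]] _] := mt.
have : v \in [set: vert E]%SET by rewrite finset.in_setT.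
rewrite -(vert01_cover E) finset.in_setU => /orP[v0|]; last by exists t, v.
case/lastP wt: {-1}(word t) (erefl (word t)) => [|w m] wt'.
  by case: t1; apply: word_inj; rewrite wt'.
exists (gen m * t * (gen m)^-1)%g, (drng m).
have wm : word t = w ++ word (gen m) by rewrite wt' /= cats1.
split; first exact: min_fixes_conj mt wm _.
have [tp _] := Ut _ Up; have mp := dom_suffix wm tp.
have sm := letter_dom_part mp.2.
have ev : dsrc m = v := part_inj sm (Uv _ Up).
case: m ev {wt wt' wm mp sm} => x []; rewrite /dsrc /drng /= => ev.
  exact: src_vert1.
by case: (vert01 (src_vert1 x)); rewrite ev.
Qed.

Lemma min_fixes_closed_path t v : min_fixes t v -> v \in vert1 E ->
  exists e1 e2 w, [/\ word t = (e2, true) :: w, last (e2, true) w = (e1, false),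
    src e1 = v & exists a s, rev (word t) = a :: s /\ closed_path a s].
Proof.
move=> mt v1; have [t1 [U [_ [p Up] Uv Ut]] _] := mt.
have [tp ep] := Ut _ Up; have cp := config_of_is_config p.
have xi1 := (config_of1 p v).2 (Uv _ Up).
have xit : config_of p (t, v) by apply/config_ofP; rewrite ep; split=> //; apply: Uv.
case wt: {1 2}(word t) => [|l w]; first by case: t1; apply: word_inj.
have [aw nl sl] := config_path cp xi1 v1 wt xit.
have vl := config_drng cp wt xit.
have [e2 el] : exists e2, l = (e2, true).
  case: l vl {wt nl sl} => x [] vl; first by exists x.
  by case: (vert01 v1); rewrite vl rng_vert0.
have [e1 elw] : exists e1, last l w = (e1, false).
  by case: (last l w) nl => x [] // _; exists x.
rewrite elw /dsrc /= in sl; subst l.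
exists e1, e2, w; split=> //.
have ew : rev ((e2, true) :: w) = (e1, false) :: rev (belast (e2, true) w).
  by rewrite lastI elw rev_rcons.
exists (e1, false), (rev (belast (e2, true) w)); split=> //.
have lr : last (e1, false) (rev (belast (e2, true) w)) = (e2, true).
  rewrite -[LHS]/(last (e1, false) ((e1, false) :: _)) -ew.
  by rewrite rev_cons last_rcons.
split; rewrite ?lr//=.
  suff : sorted (@adm_step E) ((e1, false) :: rev (belast (e2, true) w)) by [].
  by rewrite -ew -adm_word_rev revK -wt.
by rewrite sl vl.
Qed.

(** The closed path of [t] passes through a vertex with an entry, and [t] is
conjugated by the part of its word that leads there. *)
Lemma min_fixes_entry t v : conditionL E -> min_fixes t v -> v \in vert1 E ->
  exists t' v', [/\ min_fixes t' v', v' \in vert1 E & has_entry v'].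
Proof.
move=> L mt v1.
have [e1 [e2 [w0 [wt lw se1 [a [s [rw cl]]]]]]] := min_fixes_closed_path mt v1.
have [b bs en] := closed_path_entry L cl.
have {bs}[w1 [w2 ew]] : exists w1 w2, word t = w1 ++ b :: w2.
  have : b \in word t by rewrite -mem_rev rw.
  by move=> /splitPr[w1 w2]; exists w1, w2.
have [t1 [U [_ [p Up] Uv Ut]] _] := mt.
have [tp ep] := Ut _ Up; have cp := config_of_is_config p.
have rt := valP t; rewrite /= ew in rt.
have rb := reduced_catr rt.
have r2 := reduced_behead rb.
pose h : FE := FreeGroup rb; pose k : FE := FreeGroup r2.
have wh : word h = b :: word k by [].
have hp : dom h p by apply: dom_suffix tp; exact: ew.
case: b => x [] in en ew rt rb h wh hp *.
  exists (h * t * h^-1)%g, (src x); split=> //; last exact: src_vert1.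
  exact: (@min_fixes_conj t v w1 (x, true) w2 h).
case ek: w2 => [|m w3].
  exists t, v; split=> //; suff -> : v = src x by [].
  have ewl : word t = rcons w1 (x, false) by rewrite ew ek cats1.
  move: lw; rewrite -[LHS]/(last (x, false) ((e2, true) :: w0)) -wt ewl last_rcons.
  by move=> [->].
exists (k * t * k^-1)%g, (src x); split=> //; last exact: src_vert1.
have [u up] := part_ex (fn h p).
have ch : config_of p (h, u) by apply/config_ofP.
have [ck _] := cfg_tree cp wh ch.
have ekm : word k = m :: w3 by [].
have := config_drng cp ekm ck; rewrite /dsrc /= => ->.
apply: (@min_fixes_conj t v (rcons w1 (x, false)) m w3 k) => //.
by rewrite ew cat_rcons.
Qed.

End Freeness.

(** * Changing a far choice *)

Section Pumping.
Local Open Scope classical_set_scope.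
Variable E : bipartite_sepgraph.
Local Notation FE := (free_group (edge E)).
Implicit Types (g h t : FE) (x y z : edge E) (u v : vert E).

Lemma size_cons_letter (l : letter (edge E)) w :
  size (cons_letter l w) <= (size w).+1.
Proof. by case: w => //= m w; case: ifP => //= _; apply: ltnW. Qed.

(** No letters are cancelled in h t^n. *)
Lemma word_mul_expg h t a s l w : word h = a :: s -> word t = l :: w ->
  l != letter_inv (last a s) -> l != letter_inv (last l w) ->
  forall n, [/\ (exists s', word (h * t ^+ n)%g = a :: s'),
    n <= size (word (h * t ^+ n)%g) & size (word (h * t ^+ n)%g) < size (word (h * t ^+ n.+1)%g)].
Proof.
move=> wh wt nas nlw.
have H n : exists s', [/\ word (h * t ^+ n)%g = a :: s', l != letter_inv (last a s'),
    n <= size s' & word (h * t ^+ n.+1)%g = word (h * t ^+ n)%g ++ word t].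
  have step g s' : word g = a :: s' -> l != letter_inv (last a s') ->
      word (g * t)%g = word g ++ word t.
    move=> wg ns; apply: word_mul_cat; rewrite wg wt lastI.
    apply: reduced_cat => //; first by rewrite -lastI -wg; apply: (valP g).
    by rewrite -wt; apply: (valP t).
  elim: n => [|n [s' [ws ns sn wS]]].
    exists s; rewrite expg0 mulg1 expg1; split=> //; exact: step wh nas.
  exists (s' ++ word t).
  have wS' : word (h * t ^+ n.+1)%g = a :: s' ++ word t by rewrite wS ws.
  have nS : l != letter_inv (last a (s' ++ word t)) by rewrite wt last_cat.
  split=> //.
    by rewrite size_cat wt /= addnS ltnS; apply: leq_trans sn (leq_addr _ _).
  by rewrite expgSr mulgA; apply: step wS' nS.
move=> n; have [s' [ws _ sn wS]] := H n; split; first by exists s'.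
  by rewrite ws /= ltnW.
by rewrite wS size_cat wt /= addnS ltnS leq_addr.
Qed.

Variables (T : dyn_system E) (univ : universal_system T).

(** Let [xi] be the configuration of [p], and [y] its choice in the block [X] at
the end [h] of the entry.  Choosing another [y'] at the node h t^n gives
configurations [xin n], which agree with [xi] up to the length of h t^n, hence
converge to [xi].  So for large n they belong to points of U, and have period t.
But then [xin n.+1] also chooses [y'] at h t^n, where it agrees with [xi], so
that [xi] chooses both [y] and [y'] at [h]. *)
Lemma fixes_far_entry (U : set T) t p v l w x : open U -> U p -> ds_part T v p ->
  fixed_on t U -> word t = l :: w -> l != letter_inv (last l w) ->
  entry_in (config_of p) x -> l != (x, true) -> False.
Proof.
move=> oU Up vp Ut wt cyc [h [z [s [X [wh lsx xih Xz [nX cX]]]]]] nlx.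
set xi := config_of p in xih; have cp : is_config xi := config_of_is_config p.
have xi1 : xi (1%g, v) by apply/config_of1.
have inv q : U q -> forall g u, config_of q (g, u) = config_of q (g * t, u)%g.
  move=> /Ut[tq eq] g u.
  by rewrite -[in LHS]eq config_of_act.
have inv_n n g u : xi (g * t ^+ n, u)%g = xi (g, u).
  elim: n g => [|n IHn] g; first by rewrite expg0 mulg1.
  by rewrite expgS mulgA IHn; apply/esym/(inv _ Up).
have [y yX yh] := cfg_choice cp Xz xih.
have [y' y'X ny] : exists2 y', y' \in X & y' != y.
  have /card_gt0P[y'] : 0 < #|(X :\ y)%SET| by move: cX; rewrite (cardsD1 y) yX.
  by rewrite !inE => /andP[]; exists y'.
pose hn n := (h * t ^+ n)%g.
have lh : l != letter_inv (last (z, false) s) by rewrite lsx.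
have hnP n := word_mul_expg wh wt lh cyc n.
pose f n w0 X0 := if (w0 == word (hn n)) && (X0 == X) then Some y'
  else config_choice xi w0 X0.
have cf n := tree_config_is_config (policy_of_policy (f n)) v.
pose xin n := tree_config (policy_of (f n)) v.
have xin_xi n g u : size (word g) <= size (word (hn n)) -> xin n (g, u) = xi (g, u).
  move=> sg; rewrite (config_tree cp xi1) /xin.
  apply: (@eq_tree_config _ _ _ _ (size (word (hn n)))) => // w0 sw0.
  apply: funext => X0; rewrite /policy_of.
  have -> // : f n w0 X0 = config_choice xi w0 X0.
  rewrite /f; case: eqP => // ew; by rewrite ew ltnn in sw0.
have ry' : rng y' = rng z := cls_rng Xz y'X.
have xin_y' n : xin n (gen (y', true) * hn n, src y')%g.
  have [[s' ws] _ _] := hnP n.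
  rewrite /xin (tree_config_choice (policy_of_policy (f n))); last first.
    by rewrite -/(xin n) xin_xi// inv_n ry'.
  have fy' : f n (word (hn n)) X = Some y' by rewrite /f !eqxx.
  rewrite (cls_class Xz y'X) /policy_of fy' y'X [word (hn n)]ws.
  by case: ifP => // zX; move: nX; rewrite (cls_class Xz zX) eqxx.
pose tn n : tree_space E := mk_tree (cf n).
have [F [cF FK confF]] := universal_retract univ.
have tn_cvg : tn @ \oo --> orbit_tree p.
  have FF : Filter (tn @ \oo) by apply: fmap_filter.
  apply: (tree_cvg FF) => -[g u].
  suff : \forall n \near \oo, xin n (g, u) = xi (g, u) by [].
  exists (size (word g)) => // n /= gn; apply: xin_xi.
  by apply: leq_trans gn _; have [_ ? _] := hnP n.
have UF : \forall n \near \oo, U (F (tn n)).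
  have : F \o tn @ \oo --> F (orbit_tree p).
    by apply: (cvg_comp _ _ tn_cvg); apply: cF.
  by rewrite FK; apply; apply: open_nbhs_nbhs.
have [N _ NU] := UF.
have UN : U (F (tn N.+1)) by apply: NU => /=.
have xiN := inv _ UN; rewrite confF mk_treeK -/(xin N.+1) in xiN.
have := xin_y' N.+1.
rewrite /hn expgSr mulgA mulgA -xiN -mulgA -/(hn N) xin_xi; last first.
  have [_ _ sN] := hnP N; apply: leq_trans sN.
  exact: size_cons_letter.
rewrite /hn mulgA inv_n => y'h.
by move/eqP: ny; apply; apply: (cfg_choice_uniq cp) y'h yh; rewrite !(cls_class Xz).
Qed.

(** The entry must not start backwards along the closed path.  The word of t
starts with e_1 and ends with e_2r^*, and that of t^-1 starts with e_2r and ends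
with e_1^*.  As e_1 <> e_2r, the first edge of the entry differs from one of
them, so that one of t and t^-1 can be used. *)
Lemma min_fixes_no_entry t v : min_fixes T t v -> v \in vert1 E -> ~ has_entry v.
Proof.
move=> mt v1 en.
have [e1 [e2 [w [wt lw se1 _]]]] := min_fixes_closed_path mt v1.
have cyc := min_fixes_cyc mt wt.
have [_ [U [oU [p Up] Uv Ut]] _] := mt.
have vp := Uv _ Up.
have [x sx xen] := has_entry_in (config_of_is_config p) ((config_of1 p v).2 vp) en.
have [ex|nx] := eqVneq e2 x; last first.
  by apply: (fixes_far_entry oU Up vp Ut wt cyc xen); apply: contra_neq nx => -[].
have UtV : fixed_on t^-1%g U.
  move=> q Uq; have [tq eq] := Ut _ Uq; have [/=] := word_inv_act tq.
  by rewrite eq.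
have wtV : word t^-1%g = (e1, true) :: rev (map (@letter_inv _) (belast (e2, true) w)).
  rewrite -[LHS]/(word_inv (word t)) wt /word_inv lastI lw map_rcons rev_rcons.
  by [].
have lV : last (e1, true) (rev (map (@letter_inv _) (belast (e2, true) w))) = (e2, false).
  rewrite -[LHS]/(last (e1, true) ((e1, true) :: _)) -wtV.
  by rewrite -[word _]/(word_inv (word t)) wt /word_inv /= rev_cons last_rcons.
have ne : e1 != e2.
  by move: cyc; rewrite lw; apply: contra_neq => ->.
apply: (fixes_far_entry oU Up vp UtV wtV _ xen).
  by rewrite lV; apply: contra_neq ne => -[].
by rewrite -ex; apply: contra_neq ne => -[].
Qed.

Lemma conditionL_top_free : conditionL E -> topologically_free (canonical_action T).
Proof.
move=> L t t1; apply/seteqP; split=> // p ip.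
set fixset := [set x | _] in ip.
have [v vp] := part_ex p.
have ft : fixes T t v.
  exists (interior fixset `&` ds_part T v); split.
  - by apply: openI; [exact: open_interior | case: (ds_part_clopen T v)].
  - by exists p.
  - by move=> q [].
  - by move=> q [/interior_subset []]; rewrite /= /canonical_dom invgK.
have [t2 [v2 m2]] := min_fixes_ex t1 ft.
have [t3 [v3 [m3 v31]]] := min_fixes_vert1 m2.
have [t4 [v4 [m4 v41 en]]] := min_fixes_entry L m3 v31.
exact: min_fixes_no_entry m4 v41 en.
Qed.

End Pumping.

Theorem theorem10p5 (E : bipartite_sepgraph)
  (src_surj : (src @: [set: edge E] = vert1 E)%SET)
  (rng_surj : (rng @: [set: edge E] = vert0 E)%SET)
  (Omega : dyn_system E) (Omega_univ : universal_system Omega) :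
  topologically_free (canonical_action Omega) <-> conditionL E.
Proof.
split; first exact: top_free_conditionL.
exact: conditionL_top_free.
Qed.
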